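(* Let $G=(V,E)$ be a graph with $n$ vertices, $m$ edges, edge weights $w'_{ij}$ and integer vertex capacities $b'_i\ge0$, and let $\hat\beta$ be the optimum value of the linear program: maximize $\sum_{(i,j)\in E}w'_{ij}y_{ij}$ subject to $\sum_{j:(i,j)\in E}y_{ij}\le b'_i$ for all $i\in V$ and $y_{ij}\ge0$ (no edge capacity constraints). Then in $O(m)$ time and $O(n)$ space one can find an integral uncapacitated $b$-matching $\{y_{ij}\}$ (nonnegative integers with $\sum_{j}y_{ij}\le b'_i$ for all $i$) with at most $O(n)$ nonzero entries such that $\sum_{(i,j)}w'_{ij}y_{ij}\ge\hat\beta/6$.
   Context: Edges are undirected; the input is a list of edges read in one pass. *)

(* Defs.v *)
From HB Require Import structures.
From mathcomp Require Import all_boot all_order all_algebra.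

Set Implicit Arguments.
Unset Strict Implicit.
Unset Printing Implicit Defensive.

Import Order.TTheory GRing.Theory Num.Theory.
Local Open Scope ring_scope.

(* A simple graph on the vertex set 'I_n is given by its set E of edges, an
   edge being an unordered pair.  Edge-indexed data such as w'_ij is a function
   on {set 'I_n}, written w [set i; j]; only its values on E matter. *)
Definition simple_graph (n : nat) (E : {set {set 'I_n}}) : Prop :=
  forall e, e \in E -> #|e| = 2%N.

Definition lp_feasible (R : realFieldType) (n : nat) (E : {set {set 'I_n}})
    (b : 'I_n -> nat) (y : {set 'I_n} -> R) : Prop :=
  (forall i, \sum_(j | [set i; j] \in E) y [set i; j] <= (b i)%:R) /\
  (forall e, e \in E -> 0 <= y e).

Definition lp_value (R : realFieldType) (n : nat) (E : {set {set 'I_n}})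
    (w y : {set 'I_n} -> R) : R :=
  \sum_(e in E) w e * y e.

Definition lp_optimum (R : realFieldType) (n : nat) (E : {set {set 'I_n}})
    (w : {set 'I_n} -> R) (b : 'I_n -> nat) (beta : R) : Prop :=
  (exists2 y, lp_feasible E b y & lp_value E w y = beta) /\
  (forall y, lp_feasible E b y -> lp_value E w y <= beta).

Definition integral_bmatching (n : nat) (E : {set {set 'I_n}})
    (b : 'I_n -> nat) (y : {set 'I_n} -> nat) : Prop :=
  forall i, (\sum_(j | [set i; j] \in E) y [set i; j] <= b i)%N.

(* The input list: every edge occurs exactly once, in arbitrary order, with
   arbitrary orientation, together with its weight. *)
Definition edge_stream (R : realFieldType) (n : nat) (E : {set {set 'I_n}})
    (w : {set 'I_n} -> R) (s : seq ('I_n * 'I_n * R)) : Prop :=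
  perm_eq [seq [set t.1.1; t.1.2] | t <- s] (enum E) /\
  (forall t, t \in s -> t.2 = w [set t.1.1; t.1.2]).

(* The list o is exactly the list of the nonzero entries of y on E, each
   occurring once, with arbitrary orientation. *)
Definition sparse_repr (n : nat) (E : {set {set 'I_n}})
    (y : {set 'I_n} -> nat) (o : seq ('I_n * 'I_n * nat)) : Prop :=
  perm_eq [seq ([set t.1.1; t.1.2], t.2) | t <- o]
          [seq (e, y e) | e <- enum E & y e != 0%N].

(* A random access machine with two zero-initialised memories: one of
   natural numbers (words) and one of elements of R (reals).
   - Both memories have [space] cells; any access outside them is stuck.
   - Storing a natural number larger than [wmax] in the word memory is stuck,
     so that words cannot be used to pack many values into one cell.  Reals
     are handled by exact field operations and comparisons, and cannot be
     converted back to words.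
   - The number of vertices and the capacities are available through
     read-only random access; the edges are available only through the
     one-way input stream.
   - A program is a fixed piece of text that does not mention R. *)

Inductive wexp : Type :=
| WConst of nat
| WNumVertices
| WMem of wexp
| WCap of wexp
| WAdd of wexp & wexp
| WSub of wexp & wexp               (* truncated *)
| WMul of wexp & wexp.

Inductive rexp : Type :=
| ROfWord of wexp
| RMem of wexp
| RAdd of rexp & rexp
| RSub of rexp & rexp
| RMul of rexp & rexp
| RDiv of rexp & rexp.

Inductive bexp : Type :=
| BMoreEdges                        (* the input stream is not exhausted *)
| BWLe of wexp & wexp
| BRLe of rexp & rexp
| BNot of bexp
| BAnd of bexp & bexp.

Inductive cmd : Type :=
| CSkip
| CSetW of wexp & wexp              (* words[address] := value *)
| CSetR of wexp & rexp              (* reals[address] := value *)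
| CRead of wexp & wexp & wexp       (* consume one edge: the addresses receive
                                       its endpoints and its weight *)
| CEmit of wexp & wexp & wexp       (* append (i, j, y_ij) to the output *)
| CSeq of cmd & cmd
| CIf of bexp & cmd & cmd
| CWhile of bexp & cmd.

Record mstate (R : Type) (n : nat) : Type := MState {
  words  : nat -> nat;
  reals  : nat -> R;
  input  : seq ('I_n * 'I_n * R);
  output : seq ('I_n * 'I_n * nat)
}.

Definition init_state (R : realFieldType) (n : nat)
    (s : seq ('I_n * 'I_n * R)) : mstate R n :=
  MState (fun=> 0%N) (fun=> 0) s [::].

Definition omap2 (A B C : Type) (f : A -> B -> C)
    (x : option A) (y : option B) : option C :=
  if x is Some a then (if y is Some c then Some (f a c) else None) else None.

Fixpoint weval (R : realFieldType) (n : nat) (b : 'I_n -> nat) (space : nat)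
    (st : mstate R n) (e : wexp) : option nat :=
  match e with
  | WConst k => Some k
  | WNumVertices => Some n
  | WMem a =>
      if weval b space st a is Some x
      then (if (x < space)%N then Some (words st x) else None) else None
  | WCap a =>
      if weval b space st a is Some x then omap b (insub x) else None
  | WAdd e1 e2 => omap2 addn (weval b space st e1) (weval b space st e2)
  | WSub e1 e2 => omap2 subn (weval b space st e1) (weval b space st e2)
  | WMul e1 e2 => omap2 muln (weval b space st e1) (weval b space st e2)
  end.

Fixpoint reval (R : realFieldType) (n : nat) (b : 'I_n -> nat) (space : nat)
    (st : mstate R n) (e : rexp) : option R :=
  match e with
  | ROfWord a => omap (fun x => x%:R) (weval b space st a)
  | RMem a =>
      if weval b space st a is Some x
      then (if (x < space)%N then Some (reals st x) else None) else None
  | RAdd e1 e2 =>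
      omap2 (fun x y => x + y) (reval b space st e1) (reval b space st e2)
  | RSub e1 e2 =>
      omap2 (fun x y => x - y) (reval b space st e1) (reval b space st e2)
  | RMul e1 e2 =>
      omap2 (fun x y => x * y) (reval b space st e1) (reval b space st e2)
  | RDiv e1 e2 =>
      omap2 (fun x y => x / y) (reval b space st e1) (reval b space st e2)
  end.

Fixpoint beval (R : realFieldType) (n : nat) (b : 'I_n -> nat) (space : nat)
    (st : mstate R n) (e : bexp) : option bool :=
  match e with
  | BMoreEdges => Some (~~ nilp (input st))
  | BWLe e1 e2 => omap2 leq (weval b space st e1) (weval b space st e2)
  | BRLe e1 e2 =>
      omap2 (fun x y => x <= y) (reval b space st e1) (reval b space st e2)
  | BNot e1 => omap negb (beval b space st e1)
  | BAnd e1 e2 => omap2 andb (beval b space st e1) (beval b space st e2)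
  end.

Definition upd (T : Type) (f : nat -> T) (a : nat) (v : T) : nat -> T :=
  fun x => if x == a then v else f x.

(* [exec b space wmax c st t st']: started in st, the program c terminates in
   st' after t steps, within the memory limits.  Every executed command and
   every test costs one step: the expressions belong to the program text, so
   this differs from counting single operations by a factor that depends on
   the program only. *)
Inductive exec (R : realFieldType) (n : nat) (b : 'I_n -> nat)
    (space wmax : nat) : cmd -> mstate R n -> nat -> mstate R n -> Prop :=
| ExecSkip st : exec b space wmax CSkip st 1 st
| ExecSetW st a e x v :
    weval b space st a = Some x -> (x < space)%N ->
    weval b space st e = Some v -> (v <= wmax)%N ->
    exec b space wmax (CSetW a e) st 1
      (MState (upd (words st) x v) (reals st) (input st) (output st))
| ExecSetR st a e x v :
    weval b space st a = Some x -> (x < space)%N ->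
    reval b space st e = Some v ->
    exec b space wmax (CSetR a e) st 1
      (MState (words st) (upd (reals st) x v) (input st) (output st))
| ExecRead st ai aj aw xi xj xw (i j : 'I_n) (r : R) s :
    weval b space st ai = Some xi -> (xi < space)%N -> (i <= wmax)%N ->
    weval b space st aj = Some xj -> (xj < space)%N -> (j <= wmax)%N ->
    weval b space st aw = Some xw -> (xw < space)%N ->
    input st = (i, j, r) :: s ->
    exec b space wmax (CRead ai aj aw) st 1
      (MState (upd (upd (words st) xi (i : nat)) xj (j : nat))
              (upd (reals st) xw r) s (output st))
| ExecEmit st ei ej ey (i j : 'I_n) (v : nat) :
    weval b space st ei = Some (i : nat) ->
    weval b space st ej = Some (j : nat) ->
    weval b space st ey = Some v ->
    exec b space wmax (CEmit ei ej ey) st 1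
      (MState (words st) (reals st) (input st) (rcons (output st) (i, j, v)))
| ExecSeq c1 c2 st st1 st2 t1 t2 :
    exec b space wmax c1 st t1 st1 ->
    exec b space wmax c2 st1 t2 st2 ->
    exec b space wmax (CSeq c1 c2) st (t1 + t2)%N st2
| ExecIfTrue e c1 c2 st st1 t :
    beval b space st e = Some true ->
    exec b space wmax c1 st t st1 ->
    exec b space wmax (CIf e c1 c2) st t.+1 st1
| ExecIfFalse e c1 c2 st st1 t :
    beval b space st e = Some false ->
    exec b space wmax c2 st t st1 ->
    exec b space wmax (CIf e c1 c2) st t.+1 st1
| ExecWhileTrue e c st st1 st2 t1 t2 :
    beval b space st e = Some true ->
    exec b space wmax c st t1 st1 ->
    exec b space wmax (CWhile e c) st1 t2 st2 ->
    exec b space wmax (CWhile e c) st (t1 + t2).+1%N st2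
| ExecWhileFalse e c st :
    beval b space st e = Some false ->
    exec b space wmax (CWhile e c) st 1 st.

(* One program P, with one constant k, runs on every input with k (n + 1)
   cells of each memory, words of O(log (n + max_i b_i)) bits, and at most
   k (m + 1) steps. The relation says that it outputs y on the input stream s. *)
Definition runs_in_linear_time_and_space (P : cmd) (k : nat)
    (R : realFieldType) (n : nat) (E : {set {set 'I_n}}) (b : 'I_n -> nat)
    (s : seq ('I_n * 'I_n * R)) (y : {set 'I_n} -> nat) : Prop :=
  exists (t : nat) (st : mstate R n),
    [/\ exec b (k * n.+1)%N ((n + \max_(i < n) b i).+2 ^ k)%N P
          (init_state s) t st,
        (t <= k * #|E|.+1)%N &
        sparse_repr E y (output st)].

(* Main.v *)
(** Local ratio with a pruned stack.  Keep a price [q v] for every vertex.  An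
    edge [ij] of weight [w] is ignored if [w <= 2 (q i + q j)].  Otherwise its
    endpoint [o] of smaller capacity owns it, [x = w - q i - q j] is added to
    [q o] and [x * b o / b p] to the price of the other endpoint [p], and the
    edge is pushed on a stack.  At the end the stack is unwound from the most
    recent edge, each edge getting the largest amount that still fits.

    If nothing were discarded, the value would be at least the sum [X] of all
    [x * b o]: the amount taken by an edge saturates one of its endpoints.
    Moreover [\sum_v b v * q v = 2 X], and [2 q] is a feasible dual solution, so
    that [beta <= 4 X].  Discarding all but the last two edges of each owner
    bounds the stack by [2 n]; since every [x] is at least the sum of the
    previous ones of the same owner, three quarters of [X] survive, and
    [beta <= 16/3] times the value.

    The stack is a doubly linked list, from which the oldest edge of an owner
    can be removed in constant time.  In the analysis a discarded edge stays in
    the history with slot 0, because its contribution to the prices remains. *)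

Require Import Defs.
From HB Require Import structures.
From mathcomp Require Import all_boot all_order all_algebra.
From mathcomp Require Import zify ring lra.

Set Implicit Arguments.
Unset Strict Implicit.
Unset Printing Implicit Defensive.

Import Order.TTheory GRing.Theory Num.Theory.
Local Open Scope ring_scope.

(** * Local ratio with two surviving events per vertex *)

Record event (R : Type) (n : nat) : Type := Event {
  slot : nat;
  owner : 'I_n;
  partner : 'I_n;
  weight : R
}.

Definition erase (R : Type) n (z : nat) (e : event R n) : event R n :=
  Event (if slot e == z then 0%N else slot e) (owner e) (partner e) (weight e).

Section LocalRatio.
Variables (R : realFieldType) (n : nat) (b : 'I_n -> nat).
Implicit Types (H : seq (event R n)) (e : event R n) (v i : 'I_n).
Implicit Types (Y : 'I_n -> nat) (f g : event R n -> R).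

(** The scaling at the partner makes capacity times price increase equal at both ends, as long as
    the owner has the smaller capacity. *)
Definition share e v : R :=
  (v == owner e)%:R
  + (v == partner e)%:R * ((b (owner e))%:R / (b (partner e))%:R).

(** The most recent event comes first. Prices are recomputed from the weights without looking at
    slots, so discarding an event changes no price. *)
Fixpoint price H v : R :=
  if H is e :: H' then
    price H' v
    + (weight e - (price H' (owner e) + price H' (partner e))) * share e v
  else 0.

Definition gain H e : R :=
  weight e - (price H (owner e) + price H (partner e)).

Fixpoint gsum f H : R :=
  if H is e :: H' then f e * gain H' e + gsum f H' else 0.

(** Vertex [i] has the slots [2 * i + 1] and [2 * i + 2]; the shift keeps 0 free for discarded
    events and for the list sentinel. *)
Definition slot_of i (c : bool) : nat := (2 * i + 1 + c)%N.

Definition wf_event e : bool :=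
  [&& owner e != partner e, (b (owner e) <= b (partner e))%N &
      [|| slot e == 0%N, slot e == slot_of (owner e) false
        | slot e == slot_of (owner e) true]].

(** The inequality is the acceptance test [2 * (q o + q p) <= w], rewritten in terms of the gain
    [w - q o - q p]. *)
Fixpoint valid H : Prop :=
  if H is e :: H' then
    [/\ price H' (owner e) + price H' (partner e) <= gain H' e,
        wf_event e & valid H']
  else True.

Lemma share_ge0 e v : 0 <= share e v.
Proof. by rewrite /share addr_ge0 // mulr_ge0 // divr_ge0. Qed.

Lemma valid_ge0 H : valid H ->
  (forall v, 0 <= price H v) /\
  (forall f, (forall e, 0 <= f e) -> 0 <= gsum f H).
Proof.
elim: H => [|e H IH] //= [ge we /IH [p0 g0]].
have x0 : 0 <= gain H e by apply: le_trans ge; rewrite addr_ge0.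
split=> [v|f f0]; first by rewrite addr_ge0 // mulr_ge0 // share_ge0.
by rewrite addr_ge0 ?mulr_ge0 // g0.
Qed.

Lemma gain_ge0 H e : valid (e :: H) -> 0 <= gain H e.
Proof.
by move=> [ge _ /valid_ge0 [p0 _]]; apply: le_trans ge; rewrite addr_ge0.
Qed.

Lemma price_le_cons H e v : valid (e :: H) -> price H v <= price (e :: H) v.
Proof.
by move=> /gain_ge0 x0; rewrite /= lerDl mulr_ge0 // share_ge0.
Qed.

Lemma gsum_le f g H : valid H -> (forall e, wf_event e -> f e <= g e) ->
  gsum f H <= gsum g H.
Proof.
move=> + fg; elim: H => [|e H IH] //= vH; have x0 := gain_ge0 vH.
by case: vH => _ we vH; rewrite lerD ?IH // ler_wpM2r // fg.
Qed.

Lemma eq_gsum f g H : f =1 g -> gsum f H = gsum g H.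
Proof. by move=> fg; elim: H => [|e H IH] //=; rewrite fg IH. Qed.

Lemma gsumZ c f H : gsum (fun e => c * f e) H = c * gsum f H.
Proof.
elim: H => [|e H IH] /=; first by rewrite mulr0.
by rewrite IH; ring.
Qed.

Lemma gsum_sum (I : finType) (F : I -> event R n -> R) H :
  gsum (fun e => \sum_k F k e) H = \sum_k gsum (F k) H.
Proof.
elim: H => [|e H IH] /=; first by rewrite big1.
by rewrite IH big_split /= mulr_suml.
Qed.

Lemma sum_pick (T : pzSemiRingType) (F : 'I_n -> T) i :
  \sum_v F v * (v == i)%:R = F i.
Proof.
rewrite (bigD1 i) //= eqxx mulr1 big1 ?addr0 // => v /negbTE ->.
by rewrite mulr0.
Qed.

(* A partner of capacity 0 gets share x / 0 = 0, but then the owner, whose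
   capacity is not larger, contributes 0 as well. *)
Lemma capacity_share e : (b (owner e) <= b (partner e))%N ->
  (b (partner e))%:R * ((b (owner e))%:R / (b (partner e))%:R)
  = (b (owner e))%:R :> R.
Proof.
case: (b (partner e)) => [|c]; first by rewrite leqn0 => /eqP->; rewrite !mul0r.
by move=> _; rewrite mulrCA divff ?mulr1 // pnatr_eq0.
Qed.

Lemma sum_share e : wf_event e ->
  \sum_v (b v)%:R * share e v = 2 * (b (owner e))%:R.
Proof.
case/and3P=> _ le_b _; rewrite /share.
under eq_bigr do rewrite mulrDr (mulrA (b _)%:R).
rewrite big_split /= sum_pick -mulr_suml sum_pick capacity_share //.
by rewrite mulr_natl mulr2n.
Qed.

Lemma price_total H : valid H ->
  \sum_v (b v)%:R * price H v = 2 * gsum (fun e => (b (owner e))%:R) H.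
Proof.
elim: H => [|e H IH] /=; first by rewrite mulr0 big1 // => v _; rewrite mulr0.
move=> [_ we /IH eqH]; under eq_bigr do rewrite mulrDr mulrCA.
by rewrite big_split /= eqH -mulr_sumr sum_share // -/(gain H e); ring.
Qed.

(** An owner receives its gains in full, and the shares it collects as a partner only add to its
    price. *)
Lemma gsum_owner_le_price H i : valid H ->
  gsum (fun e => (owner e == i)%:R) H <= price H i.
Proof.
elim: H => [|e H IH] // vH; have x0 := gain_ge0 vH.
case: vH => _ _ vH /=; rewrite addrC lerD ?IH // -/(gain H e) mulrC.
by rewrite ler_wpM2l // /share eq_sym lerDl mulr_ge0 // divr_ge0.
Qed.

Lemma price_erase z H v : price (map (erase z) H) v = price H v.
Proof. by elim: H v => [|e H IH] v //=; rewrite !IH. Qed.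

Lemma gain_erase z H e : gain (map (erase z) H) e = gain H e.
Proof. by rewrite /gain !price_erase. Qed.

Lemma gsum_erase z f H :
  gsum f (map (erase z) H) = gsum (fun e => f (erase z e)) H.
Proof. by elim: H => [|e H IH] //=; rewrite IH gain_erase. Qed.

Lemma valid_erase z H : valid H -> valid (map (erase z) H).
Proof.
elim: H => [|e H IH] //= [ge we vH]; split; last exact: IH.
- by rewrite !price_erase gain_erase.
- by move: we; rewrite /wf_event /=; case: ifP => [_ /and3P[-> -> _]|].
Qed.

(* The last two events of each owner are the surviving ones.  Since gains at
   least double the total gain of their owner, the last one makes up half of
   that total and the last two make up three quarters of it. *)
Definition recent (tog : 'I_n -> bool) H : Prop := forall i,
  gsum (fun e => (owner e == i)%:R) H
    <= 2 * gsum (fun e => (slot e == slot_of i (~~ tog i))%:R) H /\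
  3 * gsum (fun e => (owner e == i)%:R) H
    <= 4 * gsum (fun e => ((owner e == i) && (slot e != 0%N))%:R) H.

Lemma slot_of_inj i j c d : slot_of i c = slot_of j d -> i = j /\ c = d.
Proof.
rewrite /slot_of => eq_ij; have eij : (i : nat) = j by move: eq_ij; case: c d => [] [] /=; lia.
split; first exact: val_inj.
by move: eq_ij; rewrite eij; case: c d => [] [] /=; lia.
Qed.

Lemma slot_of_neq0 i c : slot_of i c != 0%N.
Proof. by rewrite /slot_of addn1. Qed.

Lemma slot_of_eq i j c d : (slot_of i c == slot_of j d) = (i == j) && (c == d).
Proof.
by apply/eqP/andP => [/slot_of_inj[-> ->]|[/eqP-> /eqP->]].
Qed.

Lemma wf_slot_owner e i c : wf_event e -> slot e = slot_of i c -> owner e = i.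
Proof.
case/and3P=> _ _ /or3P[] /eqP->; first by move=> /esym/eqP; rewrite (negbTE (slot_of_neq0 _ _)).
  by case/slot_of_inj.
by case/slot_of_inj.
Qed.

(** [tog o] selects the slot to be overwritten, that of the older surviving event of [o]; the latest
    event of [o] is in the slot selected by [~~ tog o]. *)
Definition push (tog : 'I_n -> bool) H (o p : 'I_n) (w : R) :=
  Event (slot_of o (tog o)) o p w :: map (erase (slot_of o (tog o))) H.

Definition flip (tog : 'I_n -> bool) (o : 'I_n) : 'I_n -> bool :=
  fun v => if v == o then ~~ tog o else tog v.

Lemma valid_push tog H o p w : valid H -> o != p -> (b o <= b p)%N ->
  2 * (price H o + price H p) <= w -> valid (push tog H o p w).
Proof.
move=> vH neq le_b w_ge; split; last exact: valid_erase.
  by rewrite gain_erase !price_erase /gain /=; lra.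
by rewrite /wf_event /= neq le_b; case: (tog o); rewrite eqxx ?orbT.
Qed.

(** Let [T] be the earlier total gain of [o] and [S] its part in the latest slot, which survives.
    The test gives [T <= x] for the new gain [x], and [T <= 2 * S] held before. Hence
    [T + x <= 2 * x] and [3 * (T + x) <= 4 * x + 2 * T <= 4 * (x + S)]. *)
Lemma recent_push tog H o p w : valid H -> o != p -> (b o <= b p)%N ->
  2 * (price H o + price H p) <= w -> recent tog H ->
  recent (flip tog o) (push tog H o p w).
Proof.
move=> vH neq le_b w_ge rH i; have /gain_ge0 := valid_push tog vH neq le_b w_ge.
have [p0 _] := valid_ge0 vH.
rewrite /push /= !gsum_erase gain_erase /=; set x := gain H _ => x0.
have [r1 r2] := rH i; rewrite /flip eq_sym; case: (eqVneq i o) => [eio|nio] /=.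
- subst i; rewrite negbK eqxx slot_of_neq0 !mul1r.
  have tx : gsum (fun e => (owner e == o)%:R) H <= x.
    apply: le_trans (gsum_owner_le_price _ vH) _.
    by rewrite /x /gain /=; have := p0 o; have := p0 p; lra.
  set T := gsum _ H in r1 r2 tx *; set S := gsum _ H in r1.
  (* No older event is left in the slot just erased, so this sum is zero; its sign is enough for the
     bound. *)
  have S0 : 0 <= gsum (fun e => ((if slot e == slot_of o (tog o) then 0%N
      else slot e) == slot_of o (tog o))%:R : R) H.
    by apply: (valid_ge0 vH).2 => e; exact: ler0n.
  have SA : S <= gsum (fun e => ((owner e == o) && ((if slot e ==
      slot_of o (tog o) then 0%N else slot e) != 0%N))%:R) H.
    apply: gsum_le => // e we; rewrite ler_nat.
    case: (eqVneq (slot e) (slot_of o (~~ tog o))) => // es.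
    rewrite (wf_slot_owner we es) eqxx es slot_of_eq eqxx /=.
    by case: (tog o); rewrite /= slot_of_neq0.
  by split; lra.
(* The erased slot belongs to [o], so the events of another vertex [i] keep their slots. *)
- rewrite !slot_of_eq (eq_sym o) (negbTE nio) /= !mul0r !add0r.
  rewrite (eq_gsum (f := fun e => (_ == slot_of i _)%:R)
             (g := fun e => (slot e == slot_of i (~~ tog i))%:R)); last first.
    move=> e; case: ifP => // /eqP->.
    by rewrite slot_of_eq (eq_sym o) (negbTE nio) eq_sym (negbTE (slot_of_neq0 _ _)).
  split=> //; apply: le_trans r2 _; rewrite ler_pM2l //.
  apply: gsum_le => // e we; rewrite ler_nat; case: ifP => // /eqP es.
  by rewrite (wf_slot_owner we es) (eq_sym o) (negbTE nio).
Qed.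

Lemma survivors_three_quarters tog H : valid H -> recent tog H ->
  3 * gsum (fun e => (b (owner e))%:R) H
    <= 4 * gsum (fun e => (slot e != 0%N)%:R * (b (owner e))%:R) H.
Proof.
move=> vH rH.
(* Regrouping by owner makes the capacity a constant factor, so that the bound in [recent] applies
   to each vertex separately. *)
have E (P : event R n -> bool) :
    gsum (fun e => (P e)%:R * (b (owner e))%:R) H
    = \sum_i (b i)%:R * gsum (fun e => ((owner e == i) && P e)%:R) H.
  under eq_bigr do rewrite -gsumZ.
  rewrite -gsum_sum; apply: eq_gsum => e.
  transitivity (\sum_i ((P e)%:R * (b i)%:R) * (i == owner e)%:R : R).
    by rewrite sum_pick.
  apply: eq_bigr => i _; rewrite eq_sym.
  by case: (P e); case: (owner e == i); rewrite ?mulr1 ?mulr0 ?mul1r ?mul0r.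
rewrite (eq_gsum (g := fun e => (xpredT e)%:R * (b (owner e))%:R)); last first.
  by move=> e; rewrite mul1r.
rewrite !E !mulr_sumr; apply: ler_sum => i _.
rewrite ![_ * ((b i)%:R * _)]mulrCA ler_wpM2l //.
rewrite (eq_gsum (g := fun e => (owner e == i)%:R)) ?(rH i).2 // => e.
by rewrite andbT.
Qed.

(** * Unwinding the stack: loads and value *)

Definition amount Y e : nat :=
  if slot e == 0%N then 0%N
  else minn (b (owner e) - Y (owner e)) (b (partner e) - Y (partner e)).

Definition place Y e : 'I_n -> nat := fun v =>
  (Y v + ((v == owner e) + (v == partner e)) * amount Y e)%N.

(** [Y] is the load left by more recent events. Zero amounts are dropped because the output may
    contain nonzero entries only. *)
Fixpoint unwind H Y : seq ('I_n * 'I_n * nat) :=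
  if H is e :: H' then
    (if amount Y e == 0%N then [::] else [:: (owner e, partner e, amount Y e)])
    ++ unwind H' (place Y e)
  else [::].

Fixpoint unwind_value H Y : R :=
  if H is e :: H' then
    weight e * (amount Y e)%:R + unwind_value H' (place Y e)
  else 0.

Lemma place_le Y e : owner e != partner e -> (forall v, Y v <= b v)%N ->
  forall v, (place Y e v <= b v)%N.
Proof.
rewrite /place /amount => neq Yb v; have Yv := Yb v.
case: ifP => _; first by rewrite muln0 addn0.
case: eqVneq => [->|_].
  by rewrite (negbTE neq); have := Yb (owner e); lia.
by case: eqVneq => [->|_]; have := Yb (partner e); lia.
Qed.

Lemma unwind_load H Y : valid H -> (forall v, Y v <= b v)%N ->
  forall v, (Y v + \sum_(t <- unwind H Y)
               ((v == t.1.1) + (v == t.1.2)) * t.2 <= b v)%N.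
Proof.
elim: H Y => [|e H IH] Y /=; first by move=> _ Yb v; rewrite big_nil addn0.
move=> [_ /and3P[neq _ _] vH] Yb v.
have := IH _ vH (place_le neq Yb) v; rewrite big_cat /= {1}/place -addnA.
by case: ifP => [/eqP->|_]; rewrite ?big_nil ?big_seq1 ?muln0.
Qed.

(* The amount given to the event saturates its owner or its partner, so that
   the later gains it pays for sum up to at least the capacity of the owner. *)
Lemma amount_saturates Y e : wf_event e -> (forall v, Y v <= b v)%N ->
  slot e != 0%N ->
  (b (owner e))%:R <= (amount Y e)%:R + (Y (owner e))%:R
     + (b (owner e))%:R / (b (partner e))%:R * (Y (partner e))%:R :> R.
Proof.
case/and3P=> _ le_b _ Yb alive; rewrite /amount (negbTE alive).
set k := (b (owner e))%:R / _.
have k0 : 0 <= k by rewrite divr_ge0.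
have kb : (b (partner e))%:R * k = (b (owner e))%:R := capacity_share le_b.
have k1 : k <= 1.
  (* For a partner of capacity 0, division by zero gives [k = 0]. *)
  rewrite /k; case: (posnP (b (partner e))) => [->|bp].
    by rewrite invr0 mulr0 ler01.
  by rewrite ler_pdivrMr ?ltr0n // mul1r ler_nat.
case: leqP => _.
  rewrite -natrD subnK ?Yb // lerDl mulr_ge0 //.
(* Here the partner is saturated: the capacity of the owner is [k] times the sum of the amount and
   the load of the partner, and [k <= 1] lets the amount count in full. *)
rewrite natrB ?Yb // -[leLHS]kb.
have Yp : (Y (partner e))%:R <= (b (partner e))%:R :> R by rewrite ler_nat.
have := ler0n R (Y (owner e)); nra.
Qed.

(** Local ratio argument: the weight of an edge is its gain plus the older prices of its endpoints.
    The price part pays for the increase of the load term caused by placing the edge, and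
    [amount_saturates] handles the gain part. The load term is what more recent edges contribute to
    the events of [H]; it vanishes for [Y = 0], where the bound is applied. *)
Lemma unwind_value_ge H Y : valid H -> (forall v, Y v <= b v)%N ->
  gsum (fun e => (slot e != 0%N)%:R * (b (owner e))%:R) H
    <= unwind_value H Y + \sum_v (Y v)%:R * price H v.
Proof.
elim: H Y => [|e H IH] Y vH Yb; first by rewrite /= add0r sumr_ge0 // => v _; rewrite mulr0.
have x0 := gain_ge0 vH; have [_ we vH'] := vH.
have [neq le_b _] := and3P we.
have := IH _ vH' (place_le neq Yb); rewrite /=.
set y := amount Y e; pose k : R := (b (owner e))%:R / (b (partner e))%:R.
have -> : \sum_v (place Y e v)%:R * price H v
    = \sum_v (Y v)%:R * price H v
      + y%:R * (price H (owner e) + price H (partner e)).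
  rewrite -(sum_pick (price H) (owner e)) -(sum_pick (price H) (partner e)).
  rewrite -big_split mulr_sumr -big_split /=; apply: eq_bigr => v _.
  by rewrite /place natrD natrM natrD -/y; ring.
have -> : \sum_v (Y v)%:R * (price H v + (weight e - (price H (owner e)
        + price H (partner e))) * share e v)
    = \sum_v (Y v)%:R * price H v + gain H e
        * ((Y (owner e))%:R + k * (Y (partner e))%:R).
  rewrite -(sum_pick (fun v => (Y v)%:R) (owner e)).
  rewrite -(sum_pick (fun v => (Y v)%:R) (partner e)).
  rewrite mulr_sumr -big_split mulr_sumr -big_split /=.
  by apply: eq_bigr => v _; rewrite /share -/k -/(gain H e); ring.
have key : (slot e != 0%N)%:R * (b (owner e))%:R * gain H e
    <= (y%:R + (Y (owner e))%:R + k * (Y (partner e))%:R) * gain H e.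
  rewrite ler_wpM2r //; case: eqP => [_|/eqP alive].
    by rewrite mul0r !addr_ge0 // mulr_ge0 // divr_ge0.
  by rewrite mul1r; apply: amount_saturates.
have -> : weight e = gain H e + (price H (owner e) + price H (partner e)).
  by rewrite /gain subrK.
lra.
Qed.

End LocalRatio.

(** * Edge-indexed functions and weak duality *)

Lemma uniq_map_inj_in (T1 T2 : eqType) (f : T1 -> T2) (s : seq T1) :
  uniq (map f s) -> {in s &, injective f}.
Proof.
elim: s => [|x s IH] //= /andP[xs us] y z.
rewrite !inE => /predU1P[->|ys] /predU1P[->|zs] // eq_f.
- by rewrite eq_f map_f in xs.
- by rewrite -eq_f map_f in xs.
- exact: IH.
Qed.

Section Graph.
Variables (n : nat) (E : {set {set 'I_n}}).
Hypothesis simpleE : simple_graph E.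

Lemma edge_neq (i j : 'I_n) : [set i; j] \in E -> i != j.
Proof. by move/simpleE; rewrite cards2; case: eqP. Qed.

(** Translates the neighbour sums of the capacity constraints into sums over edges. Without loops,
    [v] and the edge determine the neighbour. *)
Lemma big_incident (T : Type) (idx : T) (op : Monoid.com_law idx)
    (F : {set 'I_n} -> T) v :
  \big[op/idx]_(j | [set v; j] \in E) F [set v; j]
  = \big[op/idx]_(e in E | v \in e) F e.
Proof.
transitivity (\big[op/idx]_(e in [set [set v; j] | j in
    [set j | [set v; j] \in E]]) F e); last first.
  apply: eq_bigl => e; apply/imsetP/andP => [[j]|[eE ve]].
    by rewrite inE => jE ->; rewrite jE !inE eqxx.
  have /eqP/cards2P[i [j [_ eij]]] := simpleE eE.
  have := ve; rewrite {1}eij !inE => /orP[] /eqP v_eq; subst v.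
    by exists j => //; rewrite inE -eij.
  by exists i; rewrite ?inE setUC -eij.
rewrite big_imset /=; first by apply: eq_bigl => j; rewrite inE.
move=> j k; rewrite !inE => /edge_neq vj /edge_neq vk /setP/(_ j).
by rewrite !inE eqxx orbT eq_sym (negbTE vj) => /esym/eqP.
Qed.

(** Replace each weight by the prices of its endpoints, exchange the two sums, and apply the
    capacity constraint at each vertex. *)
Lemma weak_duality (R : realFieldType) (w y : {set 'I_n} -> R)
    (b : 'I_n -> nat) (q : 'I_n -> R) :
  (forall v, 0 <= q v) ->
  (forall e, e \in E -> w e <= \sum_(v in e) q v) ->
  lp_feasible E b y -> lp_value E w y <= \sum_v (b v)%:R * q v.
Proof.
move=> q0 wq [y_cap y0].
apply: (@le_trans _ _ (\sum_(e in E) (\sum_(v in e) q v) * y e)).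
  by apply: ler_sum => e eE; rewrite ler_wpM2r ?y0 ?wq.
under eq_bigr do rewrite mulr_suml.
rewrite (exchange_big_dep predT) //=; apply: ler_sum => v _.
rewrite -mulr_sumr mulrC ler_wpM2r // -(big_incident +%R).
exact: y_cap.
Qed.

(** * From output lists to functions on edges *)

Definition edge_of (A : Type) (t : 'I_n * 'I_n * A) : {set 'I_n} :=
  [set t.1.1; t.1.2].

(** Written as a sum so that sums over edges can be exchanged with sums over the list; for a list
    with distinct edges at most one term is nonzero. *)
Definition multiplicity (o : seq ('I_n * 'I_n * nat)) (e : {set 'I_n}) : nat :=
  (\sum_(t <- o) (edge_of t == e) * t.2)%N.

Section Multiplicity.
Variable o : seq ('I_n * 'I_n * nat).
Hypotheses (uniq_o : uniq (map (@edge_of nat) o))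
  (oE : {subset map (@edge_of nat) o <= E}) (o_gt0 : all (fun t => t.2 != 0%N) o).

Lemma multiplicity_in t : t \in o -> multiplicity o (edge_of t) = t.2.
Proof.
move=> to; rewrite /multiplicity (bigD1_seq t) //=; last first.
  exact: map_uniq uniq_o.
rewrite eqxx mul1n big1_seq ?addn0 // => u /andP[ut uo].
case: eqP => // /(uniq_map_inj_in uniq_o uo to) eq_ut.
by rewrite eq_ut eqxx in ut.
Qed.

Lemma multiplicity_notin e :
  e \notin map (@edge_of nat) o -> multiplicity o e = 0%N.
Proof.
move=> eo; rewrite /multiplicity big1_seq // => t /andP[_ to].
by case: eqP => // te; rewrite -te map_f in eo.
Qed.

Lemma sparse_repr_multiplicity : sparse_repr E (multiplicity o) o.
Proof.
apply: uniq_perm.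
- by apply: (@map_uniq _ _ fst); rewrite -map_comp.
- rewrite map_inj_uniq => [|e e' []//].
  by apply: filter_uniq; apply: enum_uniq.
move=> [e k]; apply/mapP/mapP => [[t to [-> ->]]|[e' + [-> ->]]].
  exists (edge_of t); last by rewrite multiplicity_in.
  by rewrite mem_filter mem_enum multiplicity_in // (allP o_gt0) // oE // map_f.
rewrite mem_filter => /andP[nz _].
have /mapP[t to ->] : e' \in map (@edge_of nat) o.
  by apply: contraNT nz => /multiplicity_notin->.
by exists t; rewrite // multiplicity_in.
Qed.

Lemma card_multiplicity :
  (#|[set e in E | multiplicity o e != 0%N]| <= size o)%N.
Proof.
rewrite -(size_map (@edge_of nat)) cardE uniq_leq_size ?enum_uniq // => e.
rewrite mem_enum inE => /andP[_ nz].
by apply: contraNT nz => /multiplicity_notin->.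
Qed.

Lemma sum_multiplicity (P : pred {set 'I_n}) :
  (\sum_(e in E | P e) multiplicity o e
   = \sum_(t <- o) P (edge_of t) * t.2)%N.
Proof.
rewrite exchange_big /=; apply: eq_big_seq => t to.
have tE : edge_of t \in E by rewrite oE ?map_f.
case: (boolP (P _)) => Pt; last first.
  by rewrite mul0n big1 // => e /andP[_]; case: eqP => // <-; rewrite (negbTE Pt).
rewrite (bigD1 (edge_of t)) ?tE //= eqxx mul1n big1 ?addn0 // => e.
by rewrite eq_sym => /andP[_ /negbTE->].
Qed.

Lemma value_multiplicity (R : realFieldType) (w : {set 'I_n} -> R) :
  \sum_(e in E) w e * (multiplicity o e)%:R
  = \sum_(t <- o) w (edge_of t) * t.2%:R.
Proof.
transitivity (\sum_(e in E) \sum_(t <- o)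
    w e * ((edge_of t == e) * t.2)%N%:R).
  by apply: eq_bigr => e _; rewrite natr_sum mulr_sumr.
rewrite exchange_big /=; apply: eq_big_seq => t to.
have tE : edge_of t \in E by rewrite oE ?map_f.
rewrite (bigD1 (edge_of t)) //= eqxx mul1n big1 ?addr0 // => e.
by rewrite eq_sym => /andP[_ /negbTE->]; rewrite mulr0.
Qed.
End Multiplicity.
End Graph.

(** * The one-pass algorithm *)

Section Stream.
Variables (R : realFieldType) (n : nat) (b : 'I_n -> nat).
Implicit Types (H : seq (event R n)) (t : 'I_n * 'I_n * R).

(** The live slots, most recent first: the content of the doubly linked list kept by the program. *)
Definition ids H : seq nat := [seq z <- map (@slot R n) H | z != 0%N].

Definition event_edge (e : event R n) : {set 'I_n} := [set owner e; partner e].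

Lemma ids_erase z H : ids (map (erase z) H) = [seq y <- ids H | y != z].
Proof.
elim: H => [|e H]; rewrite /ids //= => ->.
case: (eqVneq (slot e) z) => [->|nz] /=; last by case: ifP => //=; rewrite nz.
by case: ifP => //=; rewrite eqxx.
Qed.

Lemma ids_push tog H o p w : ids (push tog H o p w)
  = slot_of o (tog o) :: [seq y <- ids H | y != slot_of o (tog o)].
Proof. by rewrite -ids_erase /push /ids /= slot_of_neq0. Qed.

Lemma valid_wf H : valid b H -> all (wf_event b) H.
Proof. by elim: H => //= e H IH [_ -> /IH]. Qed.

Lemma slot_of_bounds (i : 'I_n) c : (0 < slot_of i c <= 2 * n)%N.
Proof. by have := ltn_ord i; rewrite /slot_of; case: c; lia. Qed.

Lemma ids_bounds H z : valid b H -> z \in ids H -> (0 < z <= 2 * n)%N.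
Proof.
move/valid_wf => wfH; rewrite mem_filter => /andP[nz].
elim: H wfH => [|e H IH] //= /andP[/and3P[_ _ se] wfH].
rewrite inE => /predU1P[ez|/IH]; last exact.
by case/or3P: se nz => /eqP; rewrite -ez => -> //; rewrite slot_of_bounds.
Qed.

Lemma size_ids H : valid b H -> uniq (ids H) -> (size (ids H) <= 2 * n)%N.
Proof.
move=> vH uH; rewrite -(size_iota 1 (2 * n)) uniq_leq_size // => z /ids_bounds.
by move/(_ vH); rewrite mem_iota; lia.
Qed.

Lemma size_unwind H Y : (size (unwind b H Y) <= size (ids H))%N.
Proof.
elim: H Y => [|e H IH] Y //=; rewrite /ids /= {1 2}/amount -/(ids H).
case: (slot e == 0%N) => /=; first exact: IH.
by rewrite size_cat; case: ifP => _ /=; have := IH (place b Y e); lia.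
Qed.

Lemma edges_unwind H Y :
  subseq (map (@edge_of n nat) (unwind b H Y)) (map event_edge H).
Proof.
elim: H Y => [|e H IH] Y //=; case: ifP => _ /=; last by rewrite eqxx.
exact: subseq_trans (IH _) (subseq_cons _ _).
Qed.

Lemma unwind_neq0 H Y : all (fun u => u.2 != 0%N) (unwind b H Y).
Proof.
elim: H Y => [|e H IH] Y //=; rewrite all_cat IH andbT.
by case: ifP => //= ->.
Qed.

Lemma unwind_valueE (w : {set 'I_n} -> R) H Y :
  all (fun e => weight e == w (event_edge e)) H ->
  unwind_value b H Y = \sum_(u <- unwind b H Y) w (edge_of u) * u.2%:R.
Proof.
elim: H Y => [|e H IH] Y /=; first by rewrite big_nil.
case/andP=> /eqP we /IH ->; rewrite big_cat we /=; congr (_ + _).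
by case: ifP => [/eqP->|_]; rewrite ?big_nil ?mulr0 ?big_seq1.
Qed.

(** The functional model of one iteration of the streaming loop, against which [process_edge] is
    verified. *)
Definition observe (st : ('I_n -> bool) * seq (event R n)) t :=
  let: (tog, H) := st in let: (i, j, w) := t in
  if w <= 2 * (price b H i + price b H j) then (tog, H)
  else if (b i <= b j)%N then (flip tog i, push tog H i j w)
  else (flip tog j, push tog H j i w).

Variables (E : {set {set 'I_n}}) (w : {set 'I_n} -> R).
Hypothesis simpleE : simple_graph E.

(** Distinctness is required of the history and the remaining stream jointly, so that pushing an
    edge only permutes the combined list. *)
Definition sound (st : ('I_n -> bool) * seq (event R n))
    (rest : seq ('I_n * 'I_n * R)) : Prop :=
  [/\ valid b st.2, recent b st.1 st.2 /\ uniq (ids st.2),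
      all (fun e => weight e == w (event_edge e)) st.2,
      uniq (map event_edge st.2 ++ map (@edge_of n R) rest) &
      {subset map event_edge st.2 ++ map (@edge_of n R) rest <= E}].

(** The constraint of the dual linear program for this edge, at the dual solution given by twice the
    prices. *)
Definition covered H t : Prop :=
  w (edge_of t) <= 2 * (price b H t.1.1 + price b H t.1.2).

Lemma push_sound tog H (o p : 'I_n) rest : o != p -> (b o <= b p)%N ->
  2 * (price b H o + price b H p) <= w [set o; p] ->
  sound (tog, H) ((o, p, w [set o; p]) :: rest) ->
  sound (flip tog o, push tog H o p (w [set o; p])) rest.
Proof.
move=> neq le_b w_ge [/= vH [rH uH] wH uE sE].
have edges_erase z : map event_edge (map (erase z) H) = map event_edge H.
  by rewrite -map_comp.
have perm_edges :
    perm_eq (map event_edge (push tog H o p (w [set o; p]))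
      ++ map (@edge_of n R) rest)
    (map event_edge H ++ edge_of (o, p, w [set o; p]) :: map (@edge_of n R) rest).
  rewrite /= edges_erase {1}/event_edge /edge_of /=.
  by rewrite perm_sym perm_catC /= perm_cons perm_catC.
split=> /=.
- exact: valid_push.
- split; first exact: recent_push.
  by rewrite ids_push /= filter_uniq // mem_filter eqxx.
- by rewrite eqxx /= all_map; apply: sub_all wH.
- by rewrite -(perm_uniq perm_edges) in uE.
- by move=> e; have := sE e; rewrite -(perm_mem perm_edges); apply.
Qed.

Lemma push_price_le tog H (o p : 'I_n) v r : o != p -> (b o <= b p)%N ->
  2 * (price b H o + price b H p) <= r -> valid b H ->
  price b H v <= price b (push tog H o p r) v.
Proof.
move=> neq le_b r_ge vH; have := price_le_cons v (valid_push tog vH neq le_b r_ge).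
by rewrite price_erase.
Qed.

(** Adding the gain [r - q o - q p] to the price of the owner already lifts the sum of the two
    prices to [r], and the price of the partner does not decrease. *)
Lemma push_covers tog H (o p : 'I_n) r : o != p -> (b o <= b p)%N ->
  2 * (price b H o + price b H p) <= r -> valid b H ->
  r <= price b (push tog H o p r) o + price b (push tog H o p r) p.
Proof.
move=> neq le_b r_ge vH; have := gain_ge0 (valid_push tog vH neq le_b r_ge).
rewrite /push /= gain_erase /gain !price_erase /= => x0.
set x := r - _ in x0 *; set e := Event _ _ _ _.
have so : share b e o = 1 by rewrite /share /= eqxx (negbTE neq) mul0r addr0.
have := mulr_ge0 x0 (share_ge0 b e p); rewrite so /x; lra.
Qed.

Lemma observe_sound st t rest : t.2 = w (edge_of t) -> sound st (t :: rest) ->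
  let st' := observe st t in
  [/\ sound st' rest, covered st'.2 t,
      forall v, price b st.2 v <= price b st'.2 v &
      (size st'.2 <= (size st.2).+1)%N].
Proof.
case: st t => [tog H] [[i j] r] /= r_eq snd; rewrite /edge_of /= in r_eq; subst r.
have neq : i != j.
  apply: (edge_neq simpleE); case: snd => _ _ _ _ /(_ [set i; j]); apply.
  by rewrite mem_cat inE eqxx orbT.
have [vH _ _ _ _] := snd; case: (leP (w _)) => [r_le|/ltW r_ge].
  split=> //=; case: snd => /= vH' rH wH uE sE; split=> //=.
    by move: uE; rewrite !cat_uniq /= negb_or => /and3P[-> /andP[_ ->] /andP[_ ->]].
  by move=> e eE; apply: sE; move: eE; rewrite !mem_cat inE => /orP[->|->]; rewrite ?orbT.
have [p0 _] := valid_ge0 vH.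
case: (leqP (b i) (b j)) => [le_b|/ltnW le_b].
  split=> /=.
  - exact: push_sound.
  - rewrite /covered /edge_of /=.
    have := push_covers tog neq le_b r_ge vH; rewrite /= !price_erase.
    have := p0 i; have := p0 j; lra.
  - by move=> v; apply: push_price_le.
  - by rewrite size_map.
(* Here [j] owns the edge although the stream lists [i] first; the unordered pair is the same. *)
move: r_ge snd; rewrite /edge_of /= setUC (addrC (price b H i)) => r_ge snd.
rewrite eq_sym in neq; split=> /=.
- by apply: push_sound => //; case: snd => ????; split=> //; rewrite /edge_of /= setUC.
- rewrite /covered /edge_of /= setUC.
  have := push_covers tog neq le_b r_ge vH; rewrite /= !price_erase.
  have := p0 i; have := p0 j; lra.
- by move=> v; apply: push_price_le.
- by rewrite size_map.
Qed.

(** Prices never decrease, so an edge covered on its arrival stays covered until the end. *)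
Lemma observe_all_sound st s : (forall t, t \in s -> t.2 = w (edge_of t)) ->
  sound st s -> let st' := foldl observe st s in
  [/\ sound st' [::], forall t, t \in s -> covered st'.2 t,
      forall v, price b st.2 v <= price b st'.2 v &
      (size st'.2 <= size st.2 + size s)%N].
Proof.
elim: s st => [|t s IH] st ws snd; first by split=> //; rewrite addn0.
have [|snd1 cov1 le1 sz1] := observe_sound _ snd; first by rewrite ws ?inE ?eqxx.
have [|snd2 cov2 le2 sz2] := IH _ _ snd1.
  by move=> u us; rewrite ws // inE us orbT.
split=> //=.
- move=> u; rewrite inE => /predU1P[->|/cov2//].
  apply: le_trans cov1 _; rewrite ler_pM2l // lerD //; exact: le2.
- by move=> v; apply: le_trans (le1 v) (le2 v).
- by rewrite addnS; apply: leq_trans sz2 _; rewrite -addSn leq_add2r.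
Qed.

Definition history (s : seq ('I_n * 'I_n * R)) : seq (event R n) :=
  (foldl observe (fun=> false, [::]) s).2.

Definition solution s : seq ('I_n * 'I_n * nat) :=
  unwind b (history s) (fun=> 0%N).

Lemma sound_init s : edge_stream E w s -> sound (fun=> false, [::]) s.
Proof.
move=> [perm_s _]; split=> //=; first by split=> // i; rewrite !mulr0.
- by rewrite (perm_uniq perm_s) enum_uniq.
- by move=> e; rewrite (perm_mem perm_s) mem_enum.
Qed.

Lemma stream_sound s : edge_stream E w s ->
  [/\ sound (foldl observe (fun=> false, [::]) s) [::],
      forall t, t \in s -> covered (history s) t & (size (history s) <= #|E|)%N].
Proof.
move=> str; have [perm_s ws] := str.
have [snd cov _ sz] := observe_all_sound ws (sound_init str).
by split=> //; rewrite cardE -(perm_size perm_s) size_map; apply: sz.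
Qed.

Lemma solution_correct s beta : edge_stream E w s -> lp_optimum E w b beta ->
  let y := multiplicity (solution s) in
  [/\ sparse_repr E y (solution s), integral_bmatching E b y,
      (#|[set e in E | y e != 0%N]| <= 2 * n)%N &
      beta / 6 <= \sum_(e in E) w e * (y e)%:R].
Proof.
move=> str [[y feas <-] _]; have [[vH [rH uH] wH uE sE] cov _] := stream_sound str.
move: vH rH uH wH uE sE; rewrite -/(history s) /= !cats0 => vH rH uH wH uE sE.
have [perm_s _] := str; set o := solution s.
have uo : uniq (map (@edge_of n nat) o) by apply: subseq_uniq (edges_unwind _ _) uE.
have oE : {subset map (@edge_of n nat) o <= E}.
  by move=> e /(mem_subseq (edges_unwind _ _))/sE.
have o0 : all (fun u => u.2 != 0%N) o := unwind_neq0 _ _.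
have [p0 g0] := valid_ge0 vH.
split.
- exact: sparse_repr_multiplicity.
- move=> v; rewrite (big_incident simpleE addn) sum_multiplicity //.
  have := unwind_load (Y := fun=> 0%N) vH (fun=> leq0n _) v; rewrite add0n.
  apply: leq_trans; rewrite leq_eqVlt; apply/orP; left; apply/eqP.
  apply: eq_big_seq => t to; congr (_ * _)%N.
  (* With distinct endpoints, the two equality tests add up to the membership test. *)
  have /(edge_neq simpleE) : edge_of t \in E by rewrite oE ?map_f.
  rewrite /edge_of !inE; case: (eqVneq v t.1.1) => [->|_] /=; last by rewrite add0n.
  by move/negbTE->.
- apply: leq_trans (card_multiplicity _ _) _.
  by apply: leq_trans (size_unwind _ _) _; apply: size_ids.
rewrite value_multiplicity // -unwind_valueE //.
have := unwind_value_ge (Y := fun=> 0%N) vH (fun=> leq0n _).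
rewrite big1 ?addr0; last by move=> v _; rewrite mul0r.
have := survivors_three_quarters vH rH; have := price_total vH.
set A := gsum _ _ _; set S := gsum _ _ _; set V := unwind_value _ _ _ => tot le34 leV.
(* The chain of bounds yields the factor 16/3; relaxing it to 6 requires a nonnegative value. *)
have S0 : 0 <= S by apply: g0 => e; rewrite mulr_ge0.
(* Since all edges of the stream are covered, twice the final prices are dual feasible. *)
have : lp_value E w y <= \sum_v (b v)%:R * (2 * price b (history s) v).
  apply: (weak_duality simpleE) feas => [v|e eE]; first by rewrite mulr_ge0.
  have : e \in map (@edge_of n R) s by rewrite (perm_mem perm_s) mem_enum.
  case/mapP=> t ts et; have := cov t ts; rewrite /covered -et.
  have /(edge_neq simpleE) neq : edge_of t \in E by rewrite -et.
  by rewrite et /edge_of big_setU1 ?inE //= big_set1 mulrDr.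
under eq_bigr do rewrite mulrCA.
rewrite -mulr_sumr tot; lra.
Qed.
End Stream.

(** * Doubly linked lists *)

Section Links.
Implicit Types (P N : nat -> nat) (L : seq nat) (z : nat).

(* [L] is threaded through a circular doubly linked list with sentinel 0:
   [P] leads from each node to the next older one and [N] back. *)
Definition linked P N L : bool :=
  path (fun a c => (P a == c) && (N c == a)) 0%N (rcons L 0%N).

Lemma eq_linked P N P' N' L :
  P =1 P' -> N =1 N' -> linked P N L = linked P' N' L.
Proof. by move=> eP eN; apply: eq_path => a c; rewrite eP eN. Qed.

Lemma linked_split P N L1 z L2 : linked P N (L1 ++ z :: L2) ->
  N z = last 0%N L1 /\ P z = head 0%N L2.
Proof.
rewrite /linked rcons_cat cat_path /= => /and3P[_ /andP[_ /eqP->]].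
by case: L2 => [|y L2] /=; rewrite -?andbA => /and3P[/eqP].
Qed.

Lemma path_sub (T : eqType) (e e' : rel T) (x : T) (s : seq T) :
  (forall a c, a \in belast x s -> c \in s -> e a c -> e' a c) ->
  path e x s -> path e' x s.
Proof.
elim: s x => [|y s IH] x //= sub /andP[exy]; rewrite sub ?mem_head //=.
by apply: IH => a c aI cI; apply: sub; rewrite inE ?aI ?cI orbT.
Qed.

Lemma belast_neq_last (T : eqType) (x : T) (s : seq T) (a : T) :
  uniq (x :: s) -> a \in belast x s -> a != last x s.
Proof.
rewrite lastI rcons_uniq => /andP[lastI _].
by apply: contraTneq => ->.
Qed.

(** The two links at [z] are replaced by one between [N z] and [P z]. The sentinel spares a separate
    treatment of the ends, and distinctness of the nodes protects all other links. *)
Lemma linked_remove P N P' N' L z : uniq (0%N :: L) -> z \in L ->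
  linked P N L ->
  (forall y, P' y = if y == N z then P z else P y) ->
  (forall y, N' y = if y == P z then N z else N y) ->
  linked P' N' [seq y <- L | y != z].
Proof.
move=> + zL; case/splitPr: zL => L1 L2 uL linkL P'E N'E.
have [Nz Pz] := linked_split linkL; rewrite {}Nz {}Pz in P'E N'E.
have [z1 z2] : z \notin L1 /\ z \notin L2.
  move: uL; rewrite /= cat_uniq /= negb_or -!andbA.
  by case/and5P=> _ _ -> _ /andP[->].
have notz (L' : seq nat) : z \notin L' -> [seq y <- L' | y != z] = L'.
  by move=> zL'; apply/all_filterP/allP => y yL'; apply: contraNneq zL' => <-.
rewrite filter_cat /= eqxx !notz //.
have {uL} [u1 u2 dis] : [/\ uniq (0%N :: L1), uniq (rcons L2 0%N) &
    forall y, y \in L2 -> y \notin 0%N :: L1].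
  move: uL; rewrite /= rcons_uniq mem_cat inE !negb_or cat_uniq /=.
  case/andP=> /and3P[-> _ n0] /and3P[-> dis /andP[_ ->]].
  split=> // [|y yL2]; first by rewrite n0.
  rewrite inE negb_or; apply/andP; split.
    by apply: contraNneq n0 => <-.
  by apply: contra dis => yL1; apply/orP; right; apply/hasP; exists y.
move: linkL; rewrite /linked !rcons_cat !cat_path /= => /and3P[path1 _ path2].
apply/andP; split.
  apply: path_sub path1 => a c /(belast_neq_last u1) aN cL1.
  rewrite P'E N'E (negbTE aN) => /andP[/eqP-> /eqP->]; rewrite eqxx /=.
  (* [c] lies in [L1], so it is neither the first node of [L2] nor, when [L2] is empty, the
     sentinel. *)
  case: (eqVneq c (head 0%N L2)) => [ch|_]; last by rewrite eqxx.
  move: u1 => /= /andP[n0 _].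
  case: L2 dis ch {P'E N'E z2 path2 u2} => [_|y L2 dis] /= ch.
    by rewrite -ch cL1 in n0.
  by have := dis y (mem_head _ _); rewrite inE -ch cL1 orbT.
move: path2 u2 P'E N'E dis; case: L2 {z2} => [|h L2] /=.
  by move=> _ _ P'E N'E _; rewrite P'E N'E !eqxx.
move=> /andP[_ path2] /andP[hL2 _] P'E N'E dis; rewrite P'E N'E !eqxx /=.
apply: path_sub path2 => a c; rewrite belast_rcons => aL2 cL2.
rewrite P'E N'E => /andP[/eqP-> /eqP->].
have /negbTE-> : a != last 0%N L1.
  by apply: contraNneq (dis a aL2) => ->; apply: mem_last.
have /negbTE-> : c != h by apply: contraNneq hL2 => <-.
by rewrite !eqxx.
Qed.

(** The node goes between the sentinel and the old head [P 0]. For an empty list [P 0] is 0, and the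
    second update of [N] hits the sentinel itself. *)
Lemma linked_push P N P' N' L z : uniq (0%N :: L) -> z \notin 0%N :: L ->
  linked P N L ->
  (forall y, P' y = if y == 0%N then z else if y == z then P 0%N else P y) ->
  (forall y, N' y = if y == z then 0%N else if y == P 0%N then z else N y) ->
  linked P' N' (z :: L).
Proof.
rewrite inE negb_or => uL /andP[z0 zL] linkL P'E N'E.
rewrite /linked /= P'E N'E !eqxx /=.
have {uL} [n0 uL] : 0%N \notin L /\ uniq L by apply/andP.
move: linkL zL n0 uL; rewrite /linked; case: L => [|h L] /=.
  move=> /andP[/andP[/eqP P0 _] _] _ _ _.
  by rewrite P'E N'E (eq_sym 0%N) (negbTE z0) P0 !eqxx.
move=> /andP[/andP[/eqP P0 _] pathL].
rewrite !inE !negb_or => /andP[zh zL] /andP[h0 n0] /andP[hL uL].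
rewrite P'E N'E (eq_sym h z) (negbTE z0) (negbTE zh) P0 !eqxx /=.
apply: path_sub pathL => a c; rewrite belast_rcons => aL cL.
have a0 : a != 0%N.
  by move: aL; rewrite inE => /predU1P[->|]; [rewrite eq_sym | apply: contraTneq => ->].
have az : a != z.
  move: aL; rewrite inE => /predU1P[->|]; first by rewrite eq_sym.
  by apply: contraTneq => ->.
have cz : c != z.
  by move: cL; rewrite mem_rcons inE => /predU1P[->|]; [rewrite eq_sym | apply: contraTneq => ->].
have ch : c != h.
  by move: cL; rewrite mem_rcons inE => /predU1P[->|]; [|apply: contraTneq => ->].
by rewrite P'E N'E (negbTE a0) (negbTE az) (negbTE cz) P0 (negbTE ch).
Qed.

Lemma linked_head P N L : linked P N L -> P 0%N = head 0%N L.
Proof. by rewrite /linked; case: L => [|h L] /= /andP[/andP[/eqP]]. Qed.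

Lemma linked_mem P N L z : linked P N L -> z \in L ->
  P z \in 0%N :: L /\ N z \in 0%N :: L.
Proof.
move=> + zL; case/splitPr: zL => L1 L2 /linked_split[-> ->]; split.
  by case: L2 => [|h L2]; rewrite !inE ?mem_cat ?inE ?eqxx ?orbT.
have := mem_last 0%N L1; rewrite !inE mem_cat => /orP[->|->] //.
by rewrite orbT.
Qed.

(** Guarantees that the first write of [unlink], in the record of the older neighbour, leaves the
    record of [z] intact for the second one. *)
Lemma linked_neq P N L z : uniq (0%N :: L) -> linked P N L -> z \in L ->
  P z <> z.
Proof.
move=> + + zL; case/splitPr: zL => L1 L2 uL /linked_split[_ ->] Pz.
move: uL; rewrite /= cat_uniq /= mem_cat inE !negb_or -!andbA.
case/and5P=> _ z0 _ _ /and4P[_ _ zL2 _].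
case: L2 Pz zL2 => [|h L2] /= Pz; first by rewrite Pz eqxx in z0.
by rewrite Pz inE eqxx.
Qed.
End Links.

(** * The program and its execution *)

Definition field (x : wexp) (f : nat) : wexp :=
  WAdd (WMul (WConst 8) x) (WConst f).
Definition load (x : wexp) (f : nat) : wexp := WMem (field x f).
Definition reg (f : nat) : wexp := load (WConst 0) f.
Definition vload (v : wexp) (f : nat) : wexp := load (WAdd v (WConst 1)) f.

Notation "c1 ;; c2" := (CSeq c1 c2) (at level 70, right associativity).

(* Word memory consists of records of 8 cells.  Record 0 is the sentinel of the
   doubly linked list; its fields 2 to 5 serve as registers.  Record z with
   z > 0 holds the list node of slot z (fields 0: older node, 1: newer node,
   2: owner, 3: partner + 1, where 0 marks a free slot) and the data of vertex
   z - 1 (fields 4: which of its two slots is used next, 5: final load).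
   Real memory holds the price of vertex v in cell v; cell n is a register. *)
Definition orient : cmd :=
  CIf (BWLe (WCap (reg 2)) (WCap (reg 3))) CSkip
   (CSetW (field (WConst 0) 4) (reg 2) ;;
    CSetW (field (WConst 0) 2) (reg 3) ;;
    CSetW (field (WConst 0) 3) (reg 4) ;;
    CSkip).

Definition reprice : cmd :=
  CSetR WNumVertices
    (RSub (RMem WNumVertices) (RAdd (RMem (reg 2)) (RMem (reg 3)))) ;;
  CSetR (reg 2) (RAdd (RMem (reg 2)) (RMem WNumVertices)) ;;
  CSetR (reg 3) (RAdd (RMem (reg 3)) (RMul (RMem WNumVertices)
    (RDiv (ROfWord (WCap (reg 2))) (ROfWord (WCap (reg 3)))))) ;;
  CSetW (field (WConst 0) 4)
    (WAdd (WAdd (WMul (WConst 2) (reg 2)) (WConst 1)) (vload (reg 2) 4)) ;;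
  CSetW (field (WAdd (reg 2) (WConst 1)) 4) (WSub (WConst 1) (vload (reg 2) 4)) ;;
  CSkip.

Definition unlink : cmd :=
  CIf (BWLe (load (reg 4) 3) (WConst 0)) CSkip
   (CSetW (field (load (reg 4) 0) 1) (load (reg 4) 1) ;;
    CSetW (field (load (reg 4) 1) 0) (load (reg 4) 0) ;;
    CSkip).

(** The old head in cell 0 is used twice before it is replaced. *)
Definition link : cmd :=
  CSetW (field (reg 4) 0) (reg 0) ;;
  CSetW (field (reg 0) 1) (reg 4) ;;
  CSetW (field (reg 4) 1) (WConst 0) ;;
  CSetW (field (WConst 0) 0) (reg 4) ;;
  CSetW (field (reg 4) 2) (reg 2) ;;
  CSetW (field (reg 4) 3) (WAdd (reg 3) (WConst 1)) ;;
  CSkip.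

Definition process_edge : cmd :=
  CRead (field (WConst 0) 2) (field (WConst 0) 3) WNumVertices ;;
  CIf (BRLe (RMem WNumVertices)
         (RMul (ROfWord (WConst 2)) (RAdd (RMem (reg 2)) (RMem (reg 3)))))
    CSkip (orient ;; reprice ;; unlink ;; link ;; CSkip) ;;
  CSkip.

Definition residual (r : nat) : wexp :=
  WSub (WCap (reg r)) (vload (reg r) 5).

Definition unwind_node : cmd :=
  CSetW (field (WConst 0) 2) (load (reg 4) 2) ;;
  CSetW (field (WConst 0) 3) (WSub (load (reg 4) 3) (WConst 1)) ;;
  CIf (BWLe (residual 2) (residual 3))
    (CSetW (field (WConst 0) 5) (residual 2) ;; CSkip)
    (CSetW (field (WConst 0) 5) (residual 3) ;; CSkip) ;;
  CIf (BWLe (reg 5) (WConst 0)) CSkip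
   (CSetW (field (WAdd (reg 2) (WConst 1)) 5) (WAdd (vload (reg 2) 5) (reg 5)) ;;
    CSetW (field (WAdd (reg 3) (WConst 1)) 5) (WAdd (vload (reg 3) 5) (reg 5)) ;;
    CEmit (reg 2) (reg 3) (reg 5) ;;
    CSkip) ;;
  CSetW (field (WConst 0) 4) (load (reg 4) 0) ;;
  CSkip.

Definition bmatching_program : cmd :=
  CWhile BMoreEdges process_edge ;;
  CSetW (field (WConst 0) 4) (reg 0) ;;
  CWhile (BNot (BWLe (reg 4) (WConst 0))) unwind_node ;;
  CSkip.

(** * Executions with a time budget *)

Section Machine.
Variables (R : realFieldType) (n : nat) (b : 'I_n -> nat) (space wmax : nat).
Implicit Types (st : mstate R n) (Q : mstate R n -> Prop) (c : cmd)
  (m : nat -> nat) (r : nat -> R).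

(** A weakest precondition for total correctness: [k] bounds the number of steps, and reaching [st']
    excludes getting stuck. *)
Definition wp c k st Q : Prop :=
  exists t st', [/\ exec b space wmax c st t st', (t <= k)%N & Q st'].

Definition cap (x : nat) : nat := odflt 0%N (omap b (insub x)).

(** The partial evaluator is split into a total value and a safety condition, so that values reduce
    by computation and safety becomes linear arithmetic. *)
Fixpoint wval st (e : wexp) : nat :=
  match e with
  | WConst k => k
  | WNumVertices => n
  | WMem a => words st (wval st a)
  | WCap a => cap (wval st a)
  | WAdd e1 e2 => wval st e1 + wval st e2
  | WSub e1 e2 => wval st e1 - wval st e2
  | WMul e1 e2 => wval st e1 * wval st e2
  end%N.

Fixpoint wsafe st (e : wexp) : Prop :=
  match e with
  | WConst _ | WNumVertices => True
  | WMem a => wsafe st a /\ (wval st a < space)%N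
  | WCap a => wsafe st a /\ (wval st a < n)%N
  | WAdd e1 e2 | WSub e1 e2 | WMul e1 e2 => wsafe st e1 /\ wsafe st e2
  end.

Fixpoint rval st (e : rexp) : R :=
  match e with
  | ROfWord a => (wval st a)%:R
  | RMem a => reals st (wval st a)
  | RAdd e1 e2 => rval st e1 + rval st e2
  | RSub e1 e2 => rval st e1 - rval st e2
  | RMul e1 e2 => rval st e1 * rval st e2
  | RDiv e1 e2 => rval st e1 / rval st e2
  end.

Fixpoint rsafe st (e : rexp) : Prop :=
  match e with
  | ROfWord a => wsafe st a
  | RMem a => wsafe st a /\ (wval st a < space)%N
  | RAdd e1 e2 | RSub e1 e2 | RMul e1 e2 | RDiv e1 e2 =>
    rsafe st e1 /\ rsafe st e2
  end.

Fixpoint bval st (e : bexp) : bool :=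
  match e with
  | BMoreEdges => ~~ nilp (input st)
  | BWLe e1 e2 => (wval st e1 <= wval st e2)%N
  | BRLe e1 e2 => rval st e1 <= rval st e2
  | BNot e1 => ~~ bval st e1
  | BAnd e1 e2 => bval st e1 && bval st e2
  end.

Fixpoint bsafe st (e : bexp) : Prop :=
  match e with
  | BMoreEdges => True
  | BWLe e1 e2 => wsafe st e1 /\ wsafe st e2
  | BRLe e1 e2 => rsafe st e1 /\ rsafe st e2
  | BNot e1 => bsafe st e1
  | BAnd e1 e2 => bsafe st e1 /\ bsafe st e2
  end.

Lemma wevalE st e : wsafe st e -> weval b space st e = Some (wval st e).
Proof.
elim: e => [k||a IH|a IH|e1 IH1 e2 IH2|e1 IH1 e2 IH2|e1 IH1 e2 IH2] //=;
  try by move=> [/IH1-> /IH2->].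
- by move=> [/IH-> ->].
- by move=> [/IH-> lt_n]; rewrite /cap insubT.
Qed.

Lemma revalE st e : rsafe st e -> reval b space st e = Some (rval st e).
Proof.
elim: e => [a|a|e1 IH1 e2 IH2|e1 IH1 e2 IH2|e1 IH1 e2 IH2|e1 IH1 e2 IH2] //=;
  try by move=> [/IH1-> /IH2->].
- by move/wevalE->.
- by move=> [/wevalE-> ->].
Qed.

Lemma bevalE st e : bsafe st e -> beval b space st e = Some (bval st e).
Proof.
elim: e => [|e1 e2|e1 e2|e1 IH|e1 IH1 e2 IH2] //=.
- by move=> [/wevalE-> /wevalE->].
- by move=> [/revalE-> /revalE->].
- by move/IH->.
- by move=> [/IH1-> /IH2->].
Qed.

Lemma cap_ord (i : 'I_n) : cap i = b i.
Proof. by rewrite /cap valK. Qed.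

Lemma wp_skip k st Q : Q st -> wp CSkip k.+1 st Q.
Proof. by move=> Qst; exists 1%N, st; split=> //; apply: ExecSkip. Qed.

Lemma wp_seq c1 c2 k1 k2 st Q :
  wp c1 k1 st (fun st1 => wp c2 k2 st1 Q) -> wp (c1 ;; c2) (k1 + k2) st Q.
Proof.
case=> t1 [st1 [ex1 le1 [t2 [st2 [ex2 le2 Q2]]]]].
by exists (t1 + t2)%N, st2; split; [apply: ExecSeq ex1 ex2 | apply: leq_add |].
Qed.

Lemma wp_weaken c k k' st Q Q' : (k <= k')%N -> (forall st', Q st' -> Q' st') ->
  wp c k st Q -> wp c k' st Q'.
Proof.
by move=> le QQ [t [st' [ex le' /QQ Qst']]]; exists t, st'; split=> //; apply: leq_trans le.
Qed.

Lemma wp_then k1 k2 c1 c2 st Q1 Q :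
  wp c1 k1 st Q1 -> (forall st', Q1 st' -> wp c2 k2 st' Q) ->
  wp (c1 ;; c2) (k1 + k2) st Q.
Proof. by move=> H1 H2; apply: wp_seq; apply: wp_weaken H1. Qed.

(** The rules for atomic commands include a continuation [c]; this is why the straight-line blocks
    of the program end in [CSkip]. *)
Lemma wp_setw a e c k st Q :
  [/\ wsafe st a, (wval st a < space)%N, wsafe st e & (wval st e <= wmax)%N] ->
  wp c k (MState (upd (words st) (wval st a) (wval st e)) (reals st) (input st)
            (output st)) Q ->
  wp (CSetW a e ;; c) k.+1 st Q.
Proof.
move=> [sa lt_a se le_e] H; apply: (@wp_seq _ _ 1); exists 1%N; eexists; split=> //; last exact: H.
by apply: ExecSetW => //; apply: wevalE.
Qed.

Lemma wp_setr a e c k st Q :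
  [/\ wsafe st a, (wval st a < space)%N & rsafe st e] ->
  wp c k (MState (words st) (upd (reals st) (wval st a) (rval st e)) (input st)
            (output st)) Q ->
  wp (CSetR a e ;; c) k.+1 st Q.
Proof.
move=> [sa lt_a se] H; apply: (@wp_seq _ _ 1); exists 1%N; eexists; split=> //; last exact: H.
by apply: ExecSetR => //; [apply: wevalE | apply: revalE].
Qed.

Lemma wp_read ai aj aw c k st (i j : 'I_n) (r : R) s Q :
  [/\ wsafe st ai, (wval st ai < space)%N, wsafe st aj & (wval st aj < space)%N] ->
  [/\ wsafe st aw, (wval st aw < space)%N & (n <= wmax)%N] ->
  input st = (i, j, r) :: s ->
  wp c k (MState (upd (upd (words st) (wval st ai) i) (wval st aj) j)
            (upd (reals st) (wval st aw) r) s (output st)) Q ->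
  wp (CRead ai aj aw ;; c) k.+1 st Q.
Proof.
move=> [sai lt_i saj lt_j] [saw lt_w le_n] inp H; apply: (@wp_seq _ _ 1).
exists 1%N; eexists; split=> //; last exact: H.
by apply: (ExecRead (wevalE sai) _ _ (wevalE saj) _ _ (wevalE saw)) => //;
  apply: leq_trans le_n; apply: ltnW.
Qed.

Lemma wp_emit ei ej ey c k st (i j : 'I_n) Q :
  [/\ wsafe st ei, wsafe st ej & wsafe st ey] ->
  wval st ei = i -> wval st ej = j ->
  wp c k (MState (words st) (reals st) (input st)
            (rcons (output st) (i, j, wval st ey))) Q ->
  wp (CEmit ei ej ey ;; c) k.+1 st Q.
Proof.
move=> [si sj sy] ei_i ej_j H; apply: (@wp_seq _ _ 1).
exists 1%N; eexists; split=> //; last exact: H.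
by apply: ExecEmit; rewrite wevalE ?ei_i ?ej_j.
Qed.

Lemma wp_if e c1 c2 k st Q : bsafe st e ->
  wp (if bval st e then c1 else c2) k st Q -> wp (CIf e c1 c2) k.+1 st Q.
Proof.
move/bevalE => be [t [st' [ex le Qst']]]; exists t.+1, st'; split=> //.
case: (bval st e) be ex => be ex; first exact: ExecIfTrue be ex.
exact: ExecIfFalse be ex.
Qed.

Lemma wp_while_true e c k1 k2 st Q : bsafe st e -> bval st e ->
  wp c k1 st (fun st1 => wp (CWhile e c) k2 st1 Q) ->
  wp (CWhile e c) (k1 + k2).+1 st Q.
Proof.
move/bevalE => be ee; rewrite ee in be.
case=> t1 [st1 [ex1 le1 [t2 [st2 [ex2 le2 Q2]]]]].
exists (t1 + t2).+1, st2; split=> //; last by rewrite ltnS leq_add.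
exact: ExecWhileTrue be ex1 ex2.
Qed.

Lemma wp_while_false e c k st Q : bsafe st e -> ~~ bval st e -> Q st ->
  wp (CWhile e c) k.+1 st Q.
Proof.
move/bevalE => be /negbTE ee Qst; rewrite ee in be.
by exists 1%N, st; split=> //; apply: ExecWhileFalse.
Qed.
Lemma upd_eq (T : Type) (f : nat -> T) a v x : x = a -> upd f a v x = v.
Proof. by move=> ->; rewrite /upd eqxx. Qed.

Lemma upd_ne (T : Type) (f : nat -> T) a v x : x <> a -> upd f a v x = f x.
Proof. by rewrite /upd => /eqP/negbTE->. Qed.

Ltac upd_simpl := repeat match goal with
  | |- context [upd ?f ?a ?v ?x] =>
    first [ rewrite (@upd_ne _ f a v x); [|by lia]
          | rewrite (@upd_eq _ f a v x); [|by lia] ]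
  end.

(** The records 0 to [2 * n], of 8 cells each, take [16 * n + 8] words. Stored words are slots,
    vertices, a partner plus one, toggles, and loads or amounts bounded by a capacity. *)
Hypotheses (space_ge : (16 * n + 16 <= space)%N)
  (wmax_ge : (2 * n + 2 <= wmax)%N) (cap_le : forall i, (b i <= wmax)%N).

Lemma wp_orient m r inp out (i j : 'I_n) :
  m (8 * 0 + 2)%N = i -> m (8 * 0 + 3)%N = j ->
  wp orient 5 (MState m r inp out) (fun st => exists2 m',
    st = MState m' r inp out &
    [/\ m' (8 * 0 + 2)%N = (if (b i <= b j)%N then i else j),
        m' (8 * 0 + 3)%N = (if (b i <= b j)%N then j else i) &
        forall a, (a < 2)%N || (8 <= a)%N -> m' a = m a]).
Proof.
move=> mi mj; have := ltn_ord i; have := ltn_ord j => lt_j lt_i.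
apply: wp_if => /=; first by rewrite mi mj; do ?split; lia.
rewrite mi mj !cap_ord; case: ifP => _.
  by apply: wp_skip; exists m.
apply: wp_setw => /=; first by rewrite mi; do ?split; lia.
apply: wp_setw => /=; first by upd_simpl; rewrite mj; do ?split; lia.
apply: wp_setw => /=; first by upd_simpl; rewrite mi; do ?split; lia.
apply: wp_skip; eexists; first by [].
by split=> [||a lt_a]; upd_simpl; rewrite ?mi ?mj.
Qed.

Lemma wp_reprice m r inp out (o p : 'I_n) (c : bool) :
  o != p -> m (8 * 0 + 2)%N = o -> m (8 * 0 + 3)%N = p ->
  m (8 * (o + 1) + 4)%N = c ->
  wp reprice 6 (MState m r inp out) (fun st => exists m' r',
    [/\ st = MState m' r' inp out, m' (8 * 0 + 4)%N = slot_of o c,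
        m' (8 * (o + 1) + 4)%N = ~~ c,
        forall a, a <> (8 * 0 + 4)%N -> a <> (8 * (o + 1) + 4)%N -> m' a = m a &
        forall v : 'I_n, r' v = r v + (r n - (r o + r p))
          * ((v == o)%:R + (v == p)%:R * ((b o)%:R / (b p)%:R))]).
Proof.
move=> neq mo mp mc; have := ltn_ord o; have := ltn_ord p => lt_p lt_o.
have neq' : (o : nat) <> p by move/val_inj => eq_op; rewrite eq_op eqxx in neq.
apply: wp_setr => /=; first by rewrite mo mp; do ?split; lia.
apply: wp_setr => /=; first by rewrite mo; do ?split; lia.
apply: wp_setr => /=; first by rewrite mo mp; do ?split; lia.
apply: wp_setw => /=; first by rewrite mo mc; case: (c) => /=; do ?split; lia.
apply: wp_setw => /=; first by upd_simpl; rewrite mo mc; case: (c) => /=; do ?split; lia.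
apply: wp_skip; do 2 eexists; split; first by [].
- by upd_simpl; rewrite ?mo mc.
- by upd_simpl; rewrite ?mo; upd_simpl; rewrite ?mo mc; case: (c).
- by move=> a a1 a2; upd_simpl; rewrite ?mo; upd_simpl.
rewrite mo mp !cap_ord.
move=> v; have lt_v := ltn_ord v; case: (eqVneq v p) => [->|vp].
  by upd_simpl; rewrite (eq_sym p) (negbTE neq) /=; ring.
have vp' : (v : nat) <> p by move/val_inj => eq_op; rewrite eq_op eqxx in vp.
case: (eqVneq v o) => [->|vo]; first by upd_simpl; rewrite /=; ring.
have vo' : (v : nat) <> o by move/val_inj => eq_op; rewrite eq_op eqxx in vo.
by upd_simpl; rewrite /=; ring.
Qed.
Definition older m x := m (8 * x + 0)%N.
Definition newer m x := m (8 * x + 1)%N.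

Lemma wp_unlink m r inp out z L :
  m (8 * 0 + 4)%N = z -> (0 < z <= 2 * n)%N ->
  (m (8 * z + 3)%N != 0%N) = (z \in L) ->
  linked (older m) (newer m) L -> uniq (0%N :: L) ->
  (forall y, y \in L -> (y <= 2 * n)%N) ->
  wp unlink 4 (MState m r inp out) (fun st => exists2 m',
    st = MState m' r inp out &
    linked (older m') (newer m') [seq y <- L | y != z] /\
    forall x f, (1 < f < 8)%N -> m' (8 * x + f)%N = m (8 * x + f)%N).
Proof.
move=> mz /andP[z0 zn] used linkL uL Ln; apply: wp_if => /=.
  by rewrite mz; do ?split; lia.
rewrite mz leqn0; case: eqP used => [_|_] /= /esym zL.
  apply: wp_skip; exists m => //; split=> //.
  rewrite (_ : [seq y <- L | y != z] = L) //; apply/all_filterP/allP => y yL.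
  by apply: contraFneq zL => <-; exact: yL.
have [Pz Nz] := linked_mem linkL zL; rewrite /older /newer in Pz Nz.
have bound y : y \in 0%N :: L -> (y <= 2 * n)%N by rewrite inE => /predU1P[->|/Ln].
have {Pz} P_le := bound _ Pz; have {Nz} N_le := bound _ Nz.
have zP : m (8 * z + 0)%N <> z := linked_neq uL linkL zL.
apply: wp_setw => /=; first by rewrite mz; do ?split; lia.
apply: wp_setw => /=.
  by upd_simpl; rewrite mz; upd_simpl; do ?split; lia.
apply: wp_skip; eexists; first by [].
split=> [|x f f_bounds]; last by upd_simpl; rewrite ?mz; upd_simpl.
apply: (linked_remove uL zL linkL) => y; rewrite /older /newer.
  by upd_simpl; rewrite ?mz; upd_simpl; case: eqVneq => [->|/eqP ne]; upd_simpl.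
by upd_simpl; rewrite ?mz; upd_simpl; case: eqVneq => [->|/eqP ne]; upd_simpl.
Qed.

Lemma wp_link m r inp out z (o p : 'I_n) L :
  m (8 * 0 + 4)%N = z -> m (8 * 0 + 2)%N = o -> m (8 * 0 + 3)%N = p ->
  (0 < z <= 2 * n)%N -> linked (older m) (newer m) L -> uniq (0%N :: L) ->
  z \notin 0%N :: L -> (forall y, y \in L -> (y <= 2 * n)%N) ->
  wp link 7 (MState m r inp out) (fun st => exists2 m',
    st = MState m' r inp out &
    [/\ linked (older m') (newer m') (z :: L),
        m' (8 * z + 2)%N = o, m' (8 * z + 3)%N = p.+1,
        (forall x f, (3 < f < 8)%N -> m' (8 * x + f)%N = m (8 * x + f)%N) &
        forall x f, x <> z -> (1 < f < 8)%N -> m' (8 * x + f)%N = m (8 * x + f)%N]).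
Proof.
move=> mz mo mp /andP[z0 zn] linkL uL zL Ln.
have P0 : (m (8 * 0 + 0)%N <= 2 * n)%N.
  rewrite [m _](linked_head linkL); case: (L) Ln => [|h L'] //=; apply.
  exact: mem_head.
have := ltn_ord o; have := ltn_ord p => lt_p lt_o.
apply: wp_setw => /=; first by rewrite mz; do ?split; lia.
apply: wp_setw => /=; first by upd_simpl; rewrite mz; do ?split; lia.
apply: wp_setw => /=; first by upd_simpl; rewrite mz; do ?split; lia.
apply: wp_setw => /=; first by upd_simpl; rewrite mz; do ?split; lia.
apply: wp_setw => /=; first by upd_simpl; rewrite mz mo; do ?split; lia.
apply: wp_setw => /=; first by upd_simpl; rewrite mz mp; do ?split; lia.
apply: wp_skip; eexists; first by [].
split.
- apply: (linked_push uL zL linkL) => y; rewrite /older /newer.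
    case: (eqVneq y 0%N) => [->|/eqP y0]; first by upd_simpl.
    by case: (eqVneq y z) => [->|/eqP yz]; upd_simpl.
  case: (eqVneq y z) => [->|/eqP yz]; first by upd_simpl.
  by upd_simpl; case: eqVneq => [->|/eqP ne]; upd_simpl.
- by upd_simpl.
- by upd_simpl; rewrite mp addn1.
- by move=> x f f_bounds; upd_simpl.
- by move=> x f xz f_bounds; upd_simpl.
Qed.

(** * The history in memory and the streaming loop *)

Definition nodes_stored m (H : seq (event R n)) : bool :=
  all (fun e => (slot e != 0%N) ==>
    (m (8 * slot e + 2)%N == owner e) && (m (8 * slot e + 3)%N == (partner e).+1)) H.

(** A nonzero field 3 means a live slot; the converse follows from [nodes_stored]. Record 0 is
    excluded because its field 3 is a register. Loads stay 0 while the stream is read. *)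
Definition represents (tog : 'I_n -> bool) (H : seq (event R n)) m r : Prop :=
  [/\ linked (older m) (newer m) (ids H),
      nodes_stored m H,
      (forall z, (0 < z)%N -> m (8 * z + 3)%N != 0%N -> z \in ids H),
      (forall v : 'I_n, m (8 * (v + 1) + 4)%N = tog v) /\
      (forall v : 'I_n, m (8 * (v + 1) + 5)%N = 0%N) &
      forall v : 'I_n, r v = price b H v].

Lemma nodes_stored_slot m H z : nodes_stored m H -> z \in ids H ->
  m (8 * z + 3)%N != 0%N.
Proof.
elim: H => [|e H IH] //= /andP[stored storedH]; rewrite /ids /=.
case: ifP stored => [nz|_ _]; last exact: IH.
rewrite implyTb => /andP[_ /eqP m3]; rewrite inE => /predU1P[->|]; first by rewrite m3.
exact: IH.
Qed.

Lemma wp_accept tog H m r inp out (o p : 'I_n) w :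
  represents tog H m r -> valid b H -> uniq (ids H) -> o != p ->
  m (8 * 0 + 2)%N = o -> m (8 * 0 + 3)%N = p -> r n = w ->
  wp (reprice ;; unlink ;; link ;; CSkip) 20 (MState m r inp out) (fun st =>
    exists m' r', st = MState m' r' inp out /\
      represents (flip tog o) (push tog H o p w) m' r').
Proof.
move=> [linkH stored free [mtog mload] rprice] vH uH neq mo mp rn.
set z := slot_of o (tog o).
have /andP[z0 zn] : (0 < z <= 2 * n)%N := slot_of_bounds o (tog o).
have idsn y : y \in ids H -> (y <= 2 * n)%N by move/(ids_bounds vH)/andP=> [].
have u0H : uniq (0%N :: ids H) by rewrite /= uH andbT mem_filter eqxx.
apply: (wp_then (k2 := 14) (wp_reprice r inp out neq mo mp (mtog o))) => st1.
move=> [m1 [r1 [-> m1z m1tog m1E r1E]]].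
have m1l x f : (f < 4)%N -> m1 (8 * x + f)%N = m (8 * x + f)%N.
  by move=> f4; apply: m1E; lia.
have used : (m1 (8 * z + 3)%N != 0%N) = (z \in ids H).
  rewrite m1l //; apply/idP/idP; [exact: free | exact: nodes_stored_slot].
have link1 : linked (older m1) (newer m1) (ids H).
  by rewrite -(eq_linked _ (P := older m) (N := newer m)) // => y;
    rewrite /older /newer m1l.
have z_bounds : (0 < z <= 2 * n)%N by apply/andP.
apply: (wp_then (k2 := 10) (wp_unlink r1 inp out m1z z_bounds used link1 u0H idsn)).
move=> st2 [m2 -> [link2 m2E]].
have u2 : uniq (0%N :: [seq y <- ids H | y != z]).
  by rewrite /= filter_uniq // andbT !mem_filter eqxx /= andbF.
have z2 : z \notin 0%N :: [seq y <- ids H | y != z].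
  by rewrite inE mem_filter eqxx /= orbF -lt0n.
have m2z : m2 (8 * 0 + 4)%N = z by rewrite m2E.
have m2o : m2 (8 * 0 + 2)%N = o by rewrite m2E // m1l.
have m2p : m2 (8 * 0 + 3)%N = p by rewrite m2E // m1l.
have ids2 y : y \in [seq y <- ids H | y != z] -> (y <= 2 * n)%N.
  by rewrite mem_filter => /andP[_ /idsn].
apply: (wp_then (k2 := 3) (wp_link r1 inp out m2z m2o m2p z_bounds link2 u2 z2 ids2)).
move=> st3 [m3 -> [link3 m3o m3p m3E m3E']]; apply: wp_skip; exists m3, r1.
split=> //; split.
- by rewrite ids_push.
- rewrite /nodes_stored /= -/z m3o m3p !eqxx implybT /= all_map.
  apply: sub_all stored => e /= /implyP stored_e.
  case: (eqVneq (slot e) z) => // /eqP ez; apply/implyP => /stored_e.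
  by rewrite !m3E' // !m2E // !m1l.
- move=> y y0; rewrite ids_push inE -/z; case: (eqVneq y z) => //= yz.
  by rewrite mem_filter yz m3E' ?m2E ?m1l //; [apply: free | apply/eqP].
- split=> v; rewrite m3E // m2E //.
    rewrite /flip; case: eqVneq => [->|/eqP vo]; first by rewrite m1tog.
    have vo' : (v : nat) <> o by move/val_inj.
    by rewrite m1E ?mtog //; move: vo'; clear; lia.
  by rewrite m1E ?mload //; clear; lia.
- by move=> v; rewrite r1E /push /= !price_erase /share /= rn !rprice.
Qed.

Lemma wp_process_edge ob m r (t : 'I_n * 'I_n * R) inp out :
  represents ob.1 ob.2 m r -> valid b ob.2 -> uniq (ids ob.2) ->
  t.1.1 != t.1.2 ->
  wp process_edge 28 (MState m r (t :: inp) out) (fun st =>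
    exists m' r', st = MState m' r' inp out /\
      represents (observe b ob t).1 (observe b ob t).2 m' r').
Proof.
case: ob t => [tog H] [[i j] w] /= repH vH uH neq.
have := ltn_ord i; have := ltn_ord j => lt_j lt_i.
have neq' : (i : nat) <> j by move/val_inj => eq_ij; rewrite eq_ij eqxx in neq.
apply: wp_read => //=; try by do ?split; lia.
set m1 := upd _ _ _; set r1 := upd _ _ _.
have m1i : m1 (8 * 0 + 2)%N = i by rewrite /m1; upd_simpl.
have m1j : m1 (8 * 0 + 3)%N = j by rewrite /m1; upd_simpl.
have m1E a : a <> (8 * 0 + 2)%N -> a <> (8 * 0 + 3)%N -> m1 a = m a.
  by move=> a2 a3; rewrite /m1; upd_simpl.
have r1n : r1 n = w by rewrite /r1; upd_simpl.
have r1E (v : 'I_n) : r1 v = r v by have := ltn_ord v; rewrite /r1 => lt_v; upd_simpl.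
apply: (@wp_seq _ _ 26 1).
have [linkH stored free [mtog mload] rprice] := repH.
(* The representation ignores cells 2 to 7 of record 0 and the real cell [n], so it survives both
   the reading of the edge and [orient]. *)
have rep1 m2 : (forall a, (a < 2)%N || (8 <= a)%N -> m2 a = m1 a) ->
    represents tog H m2 r1.
  move=> m2E; have E a : (a < 2)%N || (8 <= a)%N -> m2 a = m a.
    by move=> a_bounds; rewrite m2E // m1E; lia.
  split.
  - rewrite -(eq_linked _ (P := older m) (N := newer m)) // => y;
      rewrite /older /newer E //; lia.
  - apply: sub_all stored => e /implyP stored; apply/implyP => nz.
    by have := stored nz; rewrite !E //; lia.
  - by move=> z z0; rewrite E; [apply: free | lia].
  - by split=> v; rewrite E ?mtog ?mload //; lia.
  - by move=> v; rewrite r1E.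
apply: wp_if => /=; first by rewrite m1i m1j; do ?split; lia.
rewrite m1i m1j r1n !r1E !rprice; case: ifP => _.
  by apply: wp_skip; apply: wp_skip; exists m1, r1; split=> //; apply: rep1.
apply: (wp_then (k2 := 20) (wp_orient r1 inp out m1i m1j)).
move=> st2 [m2 -> [m2o m2p m2E]].
have swap o p : o != p -> m2 (8 * 0 + 2)%N = (o : 'I_n) ->
    m2 (8 * 0 + 3)%N = (p : 'I_n) ->
  wp (reprice ;; unlink ;; link ;; CSkip) 20 (MState m2 r1 inp out) (fun st =>
    wp CSkip 1 st (fun st' => exists m' r', st' = MState m' r' inp out /\
      represents (flip tog o) (push tog H o p w) m' r')).
  move=> neq_op m2o' m2p'.
  have acc := wp_accept inp out (rep1 _ m2E) vH uH neq_op m2o' m2p' r1n.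
  apply: wp_weaken acc => // st' [m' [r' [-> rep']]].
  by apply: wp_skip; exists m', r'.
by case: ifP m2o m2p => _ m2o m2p; apply: swap; rewrite // eq_sym.
Qed.

Lemma wp_stream (E : {set {set 'I_n}}) (w : {set 'I_n} -> R) ob m r s out :
  simple_graph E -> (forall t, t \in s -> t.2 = w (edge_of t)) ->
  sound b E w ob s -> represents ob.1 ob.2 m r ->
  wp (CWhile BMoreEdges process_edge) (29 * size s + 1) (MState m r s out)
    (fun st => exists m' r', st = MState m' r' [::] out /\
      represents (foldl (observe b) ob s).1 (foldl (observe b) ob s).2 m' r').
Proof.
move=> simpleE; elim: s ob m r => [|t s IH] ob m r ws snd rep.
  by apply: wp_while_false => //; exists m, r.
have [|snd1 _ _ _] := observe_sound simpleE _ snd; first by rewrite ws ?mem_head.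
have [vH [_ uH] _ _ sE] := snd.
have neq : t.1.1 != t.1.2.
  by apply: (edge_neq simpleE); apply: sE; rewrite mem_cat mem_head orbT.
rewrite (_ : (29 * _ + 1 = (28 + (29 * size s + 1)).+1)%N); last by rewrite /=; lia.
apply: wp_while_true => //.
apply: wp_weaken (wp_process_edge s out rep vH uH neq) => // st [m' [r' [-> rep']]].
by apply: IH => // u us; rewrite ws // inE us orbT.
Qed.

(** * The unwinding loop *)

Definition loads m (Y : 'I_n -> nat) : Prop :=
  forall v : 'I_n, m (8 * (v + 1) + 5)%N = Y v.

Lemma wp_unwind_node m r inp out (e : event R n) Y :
  wf_event b e -> slot e != 0%N -> m (8 * 0 + 4)%N = slot e ->
  m (8 * slot e + 2)%N = owner e -> m (8 * slot e + 3)%N = (partner e).+1 ->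
  (m (8 * slot e + 0)%N <= 2 * n)%N -> (slot e <= 2 * n)%N ->
  loads m Y -> (forall v, Y v <= b v)%N ->
  wp unwind_node 12 (MState m r inp out) (fun st => exists2 m',
    st = MState m' r inp (out ++ if amount b Y e == 0%N then [::]
           else [:: (owner e, partner e, amount b Y e)]) &
    [/\ m' (8 * 0 + 4)%N = m (8 * slot e + 0)%N, loads m' (place b Y e) &
        forall x f, (0 < x)%N -> (f < 4)%N -> m' (8 * x + f)%N = m (8 * x + f)%N]).
Proof.
move=> /and3P[neq _ _] z0; rewrite /place /amount (negbTE z0).
set z := slot e in z0 *; set o := owner e in neq *; set p := partner e in neq *.
move=> mz mo mp mP zn mY Yb; have := ltn_ord o; have := ltn_ord p => lt_p lt_o.
have neq' : (o : nat) <> p by move/val_inj => eq_op; rewrite eq_op eqxx in neq.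
have := cap_le o; have := cap_le p => bp bo; have := Yb o; have := Yb p => Yp Yo.
have := mY o; have := mY p => mYp mYo; rewrite -lt0n in z0.
apply: wp_setw => /=; first by rewrite mz mo; clear -space_ge wmax_ge lt_o zn; do ?split; lia.
apply: wp_setw => /=.
  by upd_simpl; rewrite mz; upd_simpl; rewrite mp; clear -space_ge wmax_ge lt_p zn; do ?split; lia.
set m1 := upd _ _ _.
have m1o : m1 (8 * 0 + 2)%N = o by rewrite /m1; upd_simpl; rewrite mz mo.
have m1p : m1 (8 * 0 + 3)%N = p.
  by rewrite /m1; upd_simpl; rewrite mz; upd_simpl; rewrite mp subn1.
have m1E x f : (0 < x)%N || (f == 4%N) -> m1 (8 * x + f)%N = m (8 * x + f)%N.
  by move=> xf; rewrite /m1 !upd_ne //; move: xf; clear; lia.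
have m1z : m1 (8 * 0 + 4)%N = z by rewrite m1E.
have m1Yo : m1 (8 * (o + 1) + 5)%N = Y o by rewrite m1E ?mY ?addn_gt0 ?orbT.
have m1Yp : m1 (8 * (p + 1) + 5)%N = Y p by rewrite m1E ?mY ?addn_gt0 ?orbT.
set y := minn (b o - Y o) (b p - Y p).
have y_le : (y <= b o - Y o)%N /\ (y <= b p - Y p)%N.
  by split; [apply: geq_minl | apply: geq_minr].
apply: (wp_then (k1 := 3) (k2 := 7) (Q1 := fun st =>
    st = MState (upd m1 (8 * 0 + 5)%N y) r inp out)).
  apply: wp_if => /=.
    by rewrite m1o m1p; clear -space_ge wmax_ge lt_p lt_o; do ?split; lia.
  rewrite m1o m1p m1Yo m1Yp !cap_ord; case: ifP => y_min.
    apply: wp_setw => /=.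
      by rewrite m1o m1Yo cap_ord; clear -space_ge wmax_ge lt_p lt_o bo; do ?split; lia.
    by apply: wp_skip; rewrite m1o m1Yo cap_ord /y (minn_idPl y_min).
  apply: wp_setw => /=.
    by rewrite m1p m1Yp cap_ord; clear -space_ge wmax_ge lt_p lt_o bp; do ?split; lia.
  by apply: wp_skip; rewrite m1p m1Yp cap_ord /y (minn_idPr _) // ltnW // ltnNge y_min.
move=> _ ->; set m2 := upd _ _ _.
have m2y : m2 (8 * 0 + 5)%N = y by rewrite /m2; upd_simpl.
have m2E a : a <> (8 * 0 + 5)%N -> m2 a = m1 a by move=> ne; rewrite /m2; upd_simpl.
have {m1o} m2o : m2 (8 * 0 + 2)%N = o by rewrite m2E.
have {m1p} m2p : m2 (8 * 0 + 3)%N = p by rewrite m2E.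
have {m1z} m2z : m2 (8 * 0 + 4)%N = z by rewrite m2E.
have {m1Yo} m2Yo : m2 (8 * (o + 1) + 5)%N = Y o by rewrite m2E //; clear; lia.
have {m1Yp} m2Yp : m2 (8 * (p + 1) + 5)%N = Y p by rewrite m2E //; clear; lia.
have {m1E m2E} m2E x f : (0 < x)%N -> m2 (8 * x + f)%N = m (8 * x + f)%N.
  by move=> x0; rewrite m2E ?m1E ?x0 //; move: x0; clear; lia.
clearbody m2; clear m1.
apply: (wp_then (k1 := 5) (k2 := 2) (Q1 := fun st => exists2 m3,
    st = MState m3 r inp (out ++ if y == 0%N then [::] else [:: (o, p, y)]) &
    [/\ m3 (8 * 0 + 4)%N = z,
        loads m3 (fun v => Y v + ((v == o) + (v == p)) * y)%N &
        forall x f, (0 < x)%N -> (f < 4)%N -> m3 (8 * x + f)%N = m (8 * x + f)%N])).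
  apply: wp_if => /=; first by clear -space_ge; do ?split; lia.
  rewrite m2y leqn0; case: ifP => y0.
    apply: wp_skip; rewrite cats0; exists m2 => //; split=> // [v|x f x0 _].
      by rewrite (eqP y0) muln0 addn0 m2E ?mY ?addn_gt0 ?orbT.
    exact: m2E.
  apply: wp_setw => /=.
    by rewrite m2o m2y m2Yo; clear -space_ge wmax_ge lt_o bo y_le Yo; do ?split; lia.
  set m3 := upd _ _ _.
  have m3v (v : 'I_n) : m3 (8 * (v + 1) + 5)%N = (Y v + (v == o) * y)%N.
    rewrite /m3 m2o; case: (eqVneq v o) => [->|vo].
      by rewrite upd_eq // m2Yo m2y mul1n.
    rewrite mul0n addn0 upd_ne ?m2E ?addn_gt0 ?orbT ?mY //.
    by move=> eq_v; case/eqP: vo; apply: ord_inj; move: eq_v; clear; lia.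
  have m3E a : a <> (8 * (o + 1) + 5)%N -> m3 a = m2 a.
    by move=> ne; rewrite /m3 m2o upd_ne.
  have m3o : m3 (8 * 0 + 2)%N = o by rewrite m3E //; clear; lia.
  have m3p : m3 (8 * 0 + 3)%N = p by rewrite m3E //; clear; lia.
  have m3y : m3 (8 * 0 + 5)%N = y by rewrite m3E //; clear; lia.
  have m3z : m3 (8 * 0 + 4)%N = z by rewrite m3E //; clear; lia.
  (* Owner and partner differ, so updating the load of the owner has left that of the partner
     unchanged. *)
  have m3Yp : m3 (8 * (p + 1) + 5)%N = Y p.
    by rewrite m3v eq_sym (negbTE neq) mul0n addn0.
  clearbody m3.
  apply: wp_setw => /=.
    by rewrite m3p m3y m3Yp; clear -space_ge wmax_ge lt_p bp y_le Yp; do ?split; lia.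
  rewrite m3p m3Yp m3y.
  have upd3 a : a <> (8 * (p + 1) + 5)%N ->
      upd m3 (8 * (p + 1) + 5)%N (Y p + y)%N a = m3 a by apply: upd_ne.
  apply: (wp_emit (i := o) (j := p)) => /=.
  - by clear -space_ge; do ?split; lia.
  - by rewrite upd3 // ; clear; lia.
  - by rewrite upd3 // ; clear; lia.
  rewrite (upd3 (8 * 0 + 5)%N) ?m3y; last by clear; lia.
  apply: wp_skip; eexists; first by rewrite cats1.
  split=> [|v|x f x0 f4].
  - by rewrite upd3 //; clear; lia.
  - case: (eqVneq v p) => [->|vp].
      by rewrite upd_eq // eq_sym (negbTE neq) mul1n.
    rewrite upd3 ?m3v ?addn0 // => eq_v; case/eqP: vp.
    by apply: ord_inj; move: eq_v; clear; lia.
  - rewrite upd3; last by move: x0 f4; clear; lia.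
    by rewrite m3E ?m2E //; move: x0 f4; clear; lia.
move=> _ [m3 -> [m3z m3Y m3E]].
apply: wp_setw => /=.
  by rewrite m3z m3E //; clear -space_ge wmax_ge zn mP; do ?split; lia.
rewrite m3z m3E //; apply: wp_skip; eexists; first by [].
split=> [|v|x f x0 f4].
- by rewrite upd_eq.
- by rewrite upd_ne ?m3Y //; clear; lia.
- by rewrite upd_ne ?m3E //; move: x0 f4; clear; lia.
Qed.

(** The induction follows the whole history, while the loop visits live slots only: a discarded
    event has amount 0 and takes no iteration. The loop walks along the older pointers, hence the
    invariant is a one-way chain that ends in the sentinel, where the loop stops. *)
Lemma wp_unwind m r out (H : seq (event R n)) Y : valid b H -> nodes_stored m H ->
  sorted (fun x y => older m x == y) (rcons (ids H) 0%N) ->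
  m (8 * 0 + 4)%N = head 0%N (ids H) -> loads m Y -> (forall v, Y v <= b v)%N ->
  wp (CWhile (BNot (BWLe (reg 4) (WConst 0))) unwind_node) (13 * size H + 1)
    (MState m r [::] out) (fun st => output st = out ++ unwind b H Y).
Proof.
elim: H m out Y => [|e H IH] m out Y vH stored chain top mY Yb.
  apply: wp_while_false => /=; last by rewrite cats0.
    by clear -space_ge; do ?split; lia.
  by rewrite top.
have [_ we vH'] := vH; have [neq _ _] := and3P we.
have place_b := place_le neq Yb; case/andP: stored => stored_e stored.
rewrite /= catA; case: (eqVneq (slot e) 0%N) => [dead|alive].
  have idsE : ids (e :: H) = ids H by rewrite /ids /= dead.
  have a0 : amount b Y e = 0%N by rewrite /amount dead eqxx.
  rewrite a0 eqxx cats0; rewrite idsE in chain top.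
  apply: wp_weaken (IH m out (place b Y e) vH' stored chain top _ place_b) => //.
    by clear; lia.
  by move=> v; rewrite mY /place a0 muln0 addn0.
have idsE : ids (e :: H) = slot e :: ids H by rewrite /ids /= alive.
have ids_in z : z \in slot e :: ids H -> (0 < z <= 2 * n)%N.
  by rewrite -idsE; exact: (ids_bounds vH).
have /andP[_ ze] := ids_in _ (mem_head _ _).
rewrite idsE /= in chain top.
have P_next : m (8 * slot e + 0)%N = head 0%N (ids H).
  by move: chain; rewrite /older; case: (ids H) => [|h L] /= /andP[/eqP].
have P_le : (m (8 * slot e + 0)%N <= 2 * n)%N.
  rewrite P_next; case: (ids H) ids_in => [|h L] //= /(_ h).
  by rewrite !inE eqxx orbT => /(_ isT)/andP[].
have [/eqP mo /eqP mp] := andP (implyP stored_e alive).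
rewrite (_ : (13 * (size H).+1 + 1 = (12 + (13 * size H + 1)).+1)%N); last first.
  by clear; lia.
apply: wp_while_true => /=.
- by clear -space_ge; do ?split; lia.
- by rewrite top -ltnNge lt0n.
apply: wp_weaken (wp_unwind_node r [::] out we alive top mo mp P_le ze mY Yb) => //.
move=> st [m' -> [top' mY' m'E]]; apply: IH => //.
- apply: sub_all stored => f /implyP stored_f; apply/implyP => nz.
  by have := stored_f nz; rewrite !m'E // lt0n.
(* The iteration changes no list field of a record of positive index, and live slots are positive,
   so the rest of the chain is intact. *)
- move: (path_sorted chain) (fun z zH => ids_in z (mem_behead (s := _ :: _) zH)).
  case: (ids H) => [|h L] //= pathL bnd.
  apply: path_sub pathL => x y; rewrite belast_rcons => xL _.
  by rewrite /older m'E //; case/andP: (bnd x xL).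
- by rewrite top'.
Qed.

Lemma wp_bmatching_program (E : {set {set 'I_n}}) (w : {set 'I_n} -> R) s :
  simple_graph E -> edge_stream E w s ->
  wp bmatching_program (42 * #|E| + 4) (init_state s)
    (fun st => output st = solution b s).
Proof.
move=> simpleE str; have [snd _ sz] := stream_sound b simpleE str.
have [perm_s ws] := str.
have size_s : size s = #|E| by rewrite cardE -(perm_size perm_s) size_map.
(* In zeroed memory the sentinel points to itself and every slot is free, as the empty history
   demands. *)
have rep0 : represents (fun=> false) [::] (fun=> 0%N) (fun=> 0 : R) by [].
(* Each streamed edge costs at most 29 steps and each event of the history at most 13, loop tests
   included; the history has at most [#|E|] events. *)
suff : wp bmatching_program
    (29 * size s + 1 + (1 + (13 * size (history b s) + 1 + 1))) (init_state s)
    (fun st => output st = solution b s).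
  by apply: wp_weaken => //; rewrite size_s; move: sz; clear; lia.
apply: (wp_then (wp_stream [::] simpleE ws (sound_init b str) rep0)).
move=> st [m [r [-> [linkH stored _ [_ mload] _]]]].
rewrite -/(history b s) in linkH stored.
have [vH _ _ _ _] := snd; rewrite -/(history b s) in vH.
have top := linked_head linkH; rewrite /older in top.
have top_le : (head 0%N (ids (history b s)) <= 2 * n)%N.
  case: (ids _) (@ids_bounds _ _ b (history b s) ^~ vH) => [|h L] //= /(_ h).
  by rewrite mem_head => /(_ isT)/andP[].
apply: wp_setw => /=; first by rewrite top; move: top_le; clear -space_ge wmax_ge; do ?split; lia.
rewrite top; set m1 := upd _ _ _.
have m1E x f : (f < 4)%N || (0 < x)%N -> m1 (8 * x + f)%N = m (8 * x + f)%N.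
  by move=> xf; rewrite /m1 upd_ne //; move: xf; clear; lia.
apply: (wp_then (k2 := 1)); last first.
  by move=> st' out_eq; apply: wp_skip; exact: out_eq.
apply: (@wp_unwind m1 r [::] (history b s) (fun=> 0%N)) => //.
- apply: sub_all stored => f /implyP stored_f; apply/implyP => nz.
  by have := stored_f nz; rewrite !m1E.
- apply: (@path_sorted _ _ 0%N); apply: sub_path linkH => x y /andP[/eqP<- _].
  by rewrite /older m1E.
- by move=> v; rewrite m1E ?mload // addn_gt0 orbT.
Qed.
End Machine.

Theorem theorem12 :
  exists (P : cmd) (k : nat),
  forall (R : realFieldType) (n : nat) (E : {set {set 'I_n}})
    (w : {set 'I_n} -> R) (b : 'I_n -> nat) (beta : R)
    (s : seq ('I_n * 'I_n * R)),
  simple_graph E ->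
  lp_optimum E w b beta ->
  edge_stream E w s ->
  exists y : {set 'I_n} -> nat,
    [/\ runs_in_linear_time_and_space P k E b s y,
        integral_bmatching E b y,
        (#|[set e in E | y e != 0%N]| <= k * n)%N &
        beta / 6 <= \sum_(e in E) w e * (y e)%:R].
Proof.
(* The constant must dominate [16 * n + 16] cells, [42 * #|E| + 4] steps and [2 * n] nonzero
   entries; 100 leaves ample room. *)
exists bmatching_program, 100%N => R n E w b beta s simpleE opt str.
have [sparse feas card_y value] := solution_correct simpleE str opt.
exists (multiplicity (solution b s)); split=> //; last first.
  by apply: leq_trans card_y _; rewrite leq_mul2r orbT.
set M := (n + \max_(i < n) b i).+2.
(* From [2 <= M] follows [2 * M <= M ^ 2], and [2 * M] exceeds both [2 * n + 2] and every
   capacity. *)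
have M_le : (2 * M <= M ^ 100)%N.
  apply: (@leq_trans (M ^ 2)%N); first by rewrite -mulnn leq_mul2r orbT.
  by rewrite leq_pexp2l.
have b_le i : (b i <= M ^ 100)%N.
  apply: leq_trans M_le; apply: leq_trans (leq_bigmax i) _.
  by rewrite /M; move: (\max_(j < n) b j)%N => B; clear; lia.
have n_le : (2 * n + 2 <= M ^ 100)%N.
  by apply: leq_trans M_le; rewrite /M; clear; lia.
have space_ge : (16 * n + 16 <= 100 * n.+1)%N by clear; lia.
have [t [st [run t_le out_st]]] :=
  wp_bmatching_program space_ge n_le b_le simpleE str.
exists t, st; split=> //; last by rewrite out_st.
by apply: leq_trans t_le _; clear; lia.
Qed.
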